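(* There is an absolute constant $C'$ such that the following holds. Let $\mathcal{H}$ be an ordered $3$-uniform hypergraph on $t$ vertices with maximum degree $d$, let $s$ be a positive integer and let $\rho \in (0,1/8)$ be a real number. Then \[\overline{R}(\mathcal{H},\mathcal{K}^{(3)}_3(s)) \leq t \cdot 2^{C'\left(s^{3/2} \rho^{-30d^2} d^6 + s^2\log\left(\frac{1}{1-4\rho}\right)\right)}.\]
   Context: Ordered $3$-uniform hypergraphs are $3$-uniform hypergraphs with a linear ordering of their vertex sets; ordered copies preserve orderings. $\mathcal{K}^{(3)}_3(s)$ is the ordered complete $3$-uniform tripartite hypergraph with three consecutive intervals of $s$ vertices as parts and all triples with one vertex in each part as hyperedges. $\overline{R}(\mathcal{H},\mathcal{G})$ is the smallest $N$ such that every red-blue coloring of the hyperedges of the ordered complete $3$-uniform hypergraph on $N$ vertices contains a blue ordered copy of $\mathcal{H}$ or a red ordered copy of $\mathcal{G}$. The degree of a vertex is the number of hyperedges containing it. $\log$ is base $2$. *)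

(* Defs.v *)
From mathcomp Require Import all_boot all_order all_algebra.
From mathcomp Require Import reals exp.

Set Implicit Arguments.
Unset Strict Implicit.
Unset Printing Implicit Defensive.

(* The vertex set of an ordered hypergraph on t vertices is {0, ..., t-1} with
   its natural order: every linearly ordered t-element set is isomorphic to it
   in exactly one way. *)
Record ohypergraph3 (t : nat) := OHypergraph3 {
  hyperedges : {set {set 'I_t}};
  hyperedges_uniform : forall e, e \in hyperedges -> #|e| = 3
}.

Definition degree t (H : ohypergraph3 t) (v : 'I_t) : nat :=
  #|[set e in hyperedges H | v \in e]|.

Definition max_degree t (H : ohypergraph3 t) : nat :=
  \max_(v < t) degree H v.

Definition triples t (P : pred {set 'I_t}) : {set {set 'I_t}} :=
  [set e : {set 'I_t} | (#|e| == 3) && P e].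

Lemma triples_uniform t (P : pred {set 'I_t}) e : e \in triples P -> #|e| = 3.
Proof. by rewrite inE => /andP[/eqP]. Qed.

Definition triples_hypergraph t (P : pred {set 'I_t}) : ohypergraph3 t :=
  OHypergraph3 (@triples_uniform t P).

Definition interval_part s (k : 'I_3) : {set 'I_(3 * s)} :=
  [set v : 'I_(3 * s) | k * s <= v < k.+1 * s].

Definition complete_tripartite s : ohypergraph3 (3 * s) :=
  triples_hypergraph
    (fun e => [forall k : 'I_3, #|e :&: interval_part s k| == 1]).

Definition ordered_copy_in t n (H : ohypergraph3 t) (G : ohypergraph3 n) : Prop :=
  exists f : 'I_t -> 'I_n,
    (forall i j : 'I_t, i < j -> f i < f j) /\
    (forall e, e \in hyperedges H -> f @: e \in hyperedges G).

(* A red-blue coloring of the hyperedges of the complete 3-uniform hypergraph on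
   N vertices (true is blue, false is red); its values on sets that are not
   triples play no role. *)
Definition coloring N := {set 'I_N} -> bool.

Definition blue_part N (c : coloring N) : ohypergraph3 N :=
  triples_hypergraph (fun e => c e).

Definition red_part N (c : coloring N) : ohypergraph3 N :=
  triples_hypergraph (fun e => ~~ c e).

Definition ordered_arrow N t n (H : ohypergraph3 t) (G : ohypergraph3 n) : Prop :=
  forall c : coloring N,
    ordered_copy_in H (blue_part c) \/ ordered_copy_in G (red_part c).

Definition is_ordered_ramsey t n (H : ohypergraph3 t) (G : ohypergraph3 n)
    (N : nat) : Prop :=
  ordered_arrow N H G /\ (forall M, ordered_arrow M H G -> N <= M).

Definition log2 (R : realType) (x : R) : R := (ln x / ln 2)%R.

(* Main.v *)
Require Import Defs.
From mathcomp Require Import all_boot all_order all_algebra.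
From mathcomp Require Import reals exp.
From mathcomp Require Import boolp ring lra zify.
Set Implicit Arguments.
Unset Strict Implicit.
Unset Printing Implicit Defensive.
Import Order.TTheory GRing.Theory Num.Theory.
Local Open Scope ring_scope.

(* Cut the vertices into t consecutive intervals of size n and place vertex j of
   H in the j-th interval, uniformly and independently. If no placement makes
   all hyperedges blue, take a smallest set F of hyperedges for which, given that
   F is blue, some further hyperedge abc is blue with probability < rho.
   By minimality, conditioning on the at most 3d members of F that meet abc costs
   a factor of at least rho^(3d) only. Fixing the positions of all vertices but
   a, b, c, some choice leaves a set of triples of density >= rho^(3d)/2 with a
   fraction at most 2 rho of them blue; and since every member of F misses one of
   a, b, c, these triples are the triangles of a tripartite graph g, h, k.

   Keep the pairs (y, z) of k of large codegree whose triangles are red in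
   proportion at least 1 - 4 rho; this property survives passing to subgraphs.
   Then choose the s vertices of the first part one at a time, keeping track of
   the graph L of pairs in common red triangles with all of them. Before each
   choice, pass to a pair (Y, Z) maximizing e(Y, Z)^E / (|Y||Z|)^(E-1); at a
   maximum no restriction to Y' x Z' decreases e below the expected value by more
   than 2 e(Y, Z) / E, so that some vertex x keeps the density of L on
   N_g(x) x N_h(x) up to a factor (1 - 4 rho)(1 - 1/m), where m is about sqrt s.
   Finally L is dense enough on large enough parts to contain K_{s,s}. *)

(** * Density of bipartite graphs *)

Definition edge_count (R : realFieldType) (B C : finType) (L : B -> C -> bool)
    (Y : {set B}) (Z : {set C}) : R :=
  \sum_(y in Y) \sum_(z in Z) (L y z)%:R.

(* |Y||Z| times the E-th power of the density, written so that it is 0 when Y or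
   Z is empty. *)
Definition potential (R : realFieldType) (B C : finType) (E : nat)
    (L : B -> C -> bool) (Y : {set B}) (Z : {set C}) : R :=
  edge_count R L Y Z ^+ E / (#|Y|%:R * #|Z|%:R) ^+ E.-1.

Section BipartiteDensity.
Variables (R : realFieldType) (B C : finType).
Implicit Types (L : B -> C -> bool) (Y : {set B}) (Z : {set C}).

Lemma edge_count_ge0 L Y Z : 0 <= edge_count R L Y Z.
Proof. by apply: sumr_ge0 => y _; apply: sumr_ge0 => z _; exact: ler0n. Qed.

Lemma edge_count_le L Y Z : edge_count R L Y Z <= #|Y|%:R * #|Z|%:R.
Proof.
rewrite mulr_natl -sumr_const; apply: ler_sum => y _.
rewrite -[leRHS]mulr1 mulr_natl -sumr_const.
by apply: ler_sum => z _; case: (L y z).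
Qed.

Lemma edge_count_exchange L Y Z :
  edge_count R L Y Z = \sum_(z in Z) \sum_(y in Y) (L y z)%:R.
Proof. exact: exchange_big. Qed.

Lemma edge_count_splitl L Y Y' Z : Y' \subset Y ->
  edge_count R L Y Z = edge_count R L Y' Z + edge_count R L (Y :\: Y') Z.
Proof. by move=> /setIidPr YY'; rewrite /edge_count (big_setID Y') /= YY'. Qed.

Lemma edge_count_splitr L Y Z Z' : Z' \subset Z ->
  edge_count R L Y Z = edge_count R L Y Z' + edge_count R L Y (Z :\: Z').
Proof.
move=> /setIidPr ZZ'; rewrite !edge_count_exchange.
by rewrite (big_setID Z') /= ZZ'.
Qed.

Lemma card_setD_natr (T : finType) (S S' : {set T}) : S' \subset S ->
  #|S :\: S'|%:R = #|S|%:R - #|S'|%:R :> R.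
Proof.
by move=> SS'; rewrite cardsD (setIidPr SS') natrB ?subset_leq_card.
Qed.

(** With [h = 1/E], [v > u + h] would give [v^E > (u + h)^E >= u^(E-1) (u + E h) = u^(E-1) (u + 1)],
    which is at least [u^(E-1)]. This turns comparisons of potentials into additive bounds. *)
Lemma ler_of_exprn_le (E : nat) (u v : R) : (0 < E)%N -> 0 <= u -> 0 <= v ->
  v ^+ E <= u ^+ E.-1 -> v <= u + E%:R^-1.
Proof.
case: E => // E _ u0 v0 /= vu; rewrite leNgt; apply/negP => uv.
have h0 : 0 < E.+1%:R^-1 :> R by rewrite invr_gt0 ltr0n.
have hE : E.+1%:R^-1 * E.+1%:R = 1 :> R by rewrite mulVf // pnatr_eq0.
move: h0 hE uv; set h := E.+1%:R^-1 => h0 hE uv.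
have bernoulli k : u ^+ k * (u + h * k.+1%:R) <= (u + h) ^+ k.+1.
  elim: k => [|k IH]; first by rewrite expr0 mul1r mulr1.
  rewrite [leRHS]exprS; apply: le_trans (ler_wpM2l _ IH); last by lra.
  rewrite exprS -[k.+2%:R]natr1 -subr_ge0.
  have -> : (u + h) * (u ^+ k * (u + h * k.+1%:R)) -
    u * u ^+ k * (u + h * (k.+1%:R + 1)) = h ^+ 2 * (u ^+ k * k.+1%:R) by ring.
  by rewrite mulr_ge0 ?sqr_ge0 // mulr_ge0 ?exprn_ge0.
have lt1 : (u + h) ^+ E.+1 < v ^+ E.+1.
  by rewrite ltrXn2r // ?nnegrE; lra.
have := bernoulli E; rewrite hE => le2.
have : u ^+ E <= u ^+ E * (u + 1).
  by rewrite mulrDr mulr1 lerDr mulr_ge0 ?exprn_ge0.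
by move: lt1 le2 vu; lra.
Qed.

(** The [E]-th power of the density is the potential divided by |Y||Z|, so a subpair of maximal
    potential is at least as dense. The density inequality is cross-multiplied to avoid dividing by
    possibly empty sizes. *)
Lemma potential_max E L Y0 Z0 : (0 < E)%N -> 0 < edge_count R L Y0 Z0 ->
  exists Y Z,
    [/\ Y \subset Y0, Z \subset Z0,
        potential R E L Y0 Z0 <= potential R E L Y Z,
        edge_count R L Y0 Z0 * (#|Y|%:R * #|Z|%:R) <=
        edge_count R L Y Z * (#|Y0|%:R * #|Z0|%:R) &
        forall Y' Z', Y' \subset Y -> Z' \subset Z ->
          potential R E L Y' Z' <= potential R E L Y Z].
Proof.
move=> E0 e0.
pose P (p : {set B} * {set C}) := (p.1 \subset Y0) && (p.2 \subset Z0).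
pose F (p : {set B} * {set C}) := potential R E L p.1 p.2.
have P0 : P (Y0, Z0) by rewrite /P !subxx.
have [[Y Z] /andP[/= YY0 ZZ0] maxF] := @arg_maxP _ _ _ _ _ F P0.
exists Y, Z; split=> //; first exact: maxF P0.
- have s0 : 0 < #|Y0|%:R * #|Z0|%:R :> R by apply: lt_le_trans e0 (edge_count_le _ _ _).
  set s := #|Y|%:R * #|Z|%:R : R.
  have ss0 : s <= #|Y0|%:R * #|Z0|%:R.
    by rewrite /s -!natrM ler_nat leq_mul // subset_leq_card.
  have [s_eq0|s_neq0] := eqVneq s 0.
    by rewrite s_eq0 mulr0 mulr_ge0 ?edge_count_ge0 // ltW.
  have {s_neq0} s_gt0 : 0 < s by rewrite lt_def s_neq0 /s -natrM ler0n.
  have := maxF _ P0; rewrite /F /= /potential -/s.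
  set s' := _ * _ in s0 ss0 *.
  rewrite ler_pdivrMr ?exprn_gt0 // mulrAC ler_pdivlMr ?exprn_gt0 // => H.
  rewrite -(@ler_pXn2r _ E) ?nnegrE ?mulr_ge0 ?edge_count_ge0 ?(ltW s0) ?(ltW s_gt0) //.
  clearbody s s'; rewrite !exprMn.
  rewrite -[in s ^+ _](prednK E0) -[in s' ^+ _](prednK E0) !exprS.
  have -> : edge_count R L Y0 Z0 ^+ E * (s * s ^+ E.-1) =
    (edge_count R L Y0 Z0 ^+ E * s ^+ E.-1) * s by ring.
  have -> : edge_count R L Y Z ^+ E * (s' * s' ^+ E.-1) =
    (edge_count R L Y Z ^+ E * s' ^+ E.-1) * s' by ring.
  by apply: ler_pM => //; rewrite ?mulr_ge0 ?exprn_ge0 ?edge_count_ge0 // ltW.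
- move=> Y' Z' YY' ZZ'; apply: (maxF (Y', Z')).
  by rewrite /P /= (subset_trans YY') // (subset_trans ZZ').
Qed.

Section MaximalPair.
Variables (E : nat) (L : B -> C -> bool) (Y : {set B}) (Z : {set C}).
Hypotheses (E0 : (0 < E)%N) (e0 : 0 < edge_count R L Y Z).
Hypothesis maxYZ : forall Y' Z', Y' \subset Y -> Z' \subset Z ->
  potential R E L Y' Z' <= potential R E L Y Z.

Let lam := edge_count R L Y Z / (#|Y|%:R * #|Z|%:R).

Lemma maximal_pair_card_gt0 : 0 < #|Y|%:R * #|Z|%:R :> R.
Proof. exact: lt_le_trans e0 (edge_count_le _ _ _). Qed.

(** Maximality reads [(e'/e)^E <= (s'/s)^(E-1)] for the edge counts [e'], [e] and sizes [s'], [s] of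
    the two pairs, so that [e'/e <= s'/s + 1/E] by [ler_of_exprn_le]. *)
Lemma maximal_pair_upper Y' Z' : Y' \subset Y -> Z' \subset Z ->
  edge_count R L Y' Z' <=
  lam * (#|Y'|%:R * #|Z'|%:R) + edge_count R L Y Z / E%:R.
Proof.
move=> YY' ZZ'; have s0 := maximal_pair_card_gt0; have e_gt0 := e0.
rewrite /lam; set e := edge_count R L Y Z in e_gt0 *.
have [-> | e'0] := eqVneq (edge_count R L Y' Z') 0.
  by rewrite addr_ge0 ?mulr_ge0 ?invr_ge0 ?ler0n // ltW.
have {}e'0 : 0 < edge_count R L Y' Z' by rewrite lt_def e'0 edge_count_ge0.
have s'0 : 0 < #|Y'|%:R * #|Z'|%:R :> R := lt_le_trans e'0 (edge_count_le _ _ _).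
have := maxYZ YY' ZZ'; rewrite /potential -/e.
set e' := edge_count R L Y' Z' in e'0 *.
rewrite ler_pdivrMr ?exprn_gt0 // mulrAC ler_pdivlMr ?exprn_gt0 //.
move: s0 s'0; set s := #|Y|%:R * _; set s' := #|Y'|%:R * _ => s0 s'0 H.
have : e' / e <= s' / s + E%:R^-1.
  apply: ler_of_exprn_le E0 _ _ _; rewrite ?divr_ge0
    ?(ltW e_gt0) ?(ltW e'0) ?(ltW s0) ?(ltW s'0) //.
  rewrite !expr_div_n ler_pdivrMr ?exprn_gt0 // mulrAC ler_pdivlMr ?exprn_gt0 //.
  by rewrite [leRHS]mulrC.
rewrite ler_pdivrMr // => /le_trans; apply.
by rewrite mulrDl ![_ * e]mulrC mulrA mulrAC.
Qed.

(** The complement of Y' x Z' in Y x Z splits into (Y \ Y') x Z and Y' x (Z \ Z'). The upper bounds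
    for these two rectangles have main terms that add up exactly, and each contributes one error
    [e/E]. *)
Lemma maximal_pair_lower Y' Z' : Y' \subset Y -> Z' \subset Z ->
  lam * (#|Y'|%:R * #|Z'|%:R) - 2 * (edge_count R L Y Z / E%:R) <=
  edge_count R L Y' Z'.
Proof.
move=> YY' ZZ'; have s0 := maximal_pair_card_gt0.
have := maximal_pair_upper (subsetDl Y Y') (subxx Z).
have := maximal_pair_upper YY' (subsetDl Z Z').
have := edge_count_splitl L Z YY'; have := edge_count_splitr L Y' ZZ'.
rewrite !card_setD_natr //.
have : lam * (#|Y|%:R * #|Z|%:R) = edge_count R L Y Z.
  by rewrite /lam mulfVK // gt_eqF.
rewrite !mulrBl !mulrBr; lra.
Qed.

End MaximalPair.
End BipartiteDensity.

(** * Choosing the first part of the red tripartite hypergraph *)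

Lemma sum_indicator (R : realFieldType) (T : finType) (P : pred T) :
  \sum_x (P x)%:R = #|[set x | P x]|%:R :> R.
Proof.
rewrite -sum1_card natr_sum [RHS]big_mkcond /=.
by apply: eq_bigr => x _; rewrite inE; case: (P x).
Qed.

Lemma edge_count_restrict (R : realFieldType) (B C : finType)
    (L : B -> C -> bool) (Y : {set B}) (Z : {set C}) (p : pred B) (q : pred C) :
  edge_count R L (Y :&: [set y | p y]) (Z :&: [set z | q z]) =
  edge_count R (fun y z => L y z && (p y && q z)) Y Z.
Proof.
rewrite /edge_count.
under eq_bigl => y do rewrite !inE.
rewrite big_mkcondr; apply: eq_bigr => y _.
under eq_bigl => z do rewrite !inE.
rewrite big_mkcondr /=; case: (p y) => /=.
  by apply: eq_bigr => z _; case: (q z); rewrite ?andbT ?andbF.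
by under [RHS]eq_bigr => z _ do rewrite andbF; rewrite big1_eq.
Qed.

Section RedStep.
Variables (R : realFieldType) (A B C : finType).
Variables (g : A -> B -> bool) (h : A -> C -> bool) (red : A -> B -> C -> bool).
Hypothesis red_gh : forall x y z, red x y z -> g x y && h x z.
Variables (K : B -> C -> bool) (a : R) (D m : nat).
Hypotheses (D_gt0 : (0 < D)%N) (m_gt0 : (0 < m)%N).
Hypotheses (a_gt0 : 0 < a) (A_gt0 : (0 < #|A|)%N).
Hypothesis K_red : forall y z, K y z ->
  a * #|[set x | g x y && h x z]|%:R <= #|[set x | red x y z]|%:R.
Hypothesis K_codegree : forall y z, K y z ->
  #|A|%:R <= D%:R * #|[set x | g x y && h x z]|%:R :> R.

Lemma sum_edge_count_and (P : A -> B -> C -> bool) L (Y : {set B}) (Z : {set C}) :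
  \sum_x edge_count R (fun y z => L y z && P x y z) Y Z =
  \sum_(y in Y) \sum_(z in Z) (L y z)%:R * #|[set x | P x y z]|%:R.
Proof.
rewrite /edge_count exchange_big; apply: eq_bigr => y _.
rewrite exchange_big; apply: eq_bigr => z _.
rewrite -sum_indicator mulr_sumr; apply: eq_bigr => x _.
by case: (L y z) => /=; rewrite ?mul1r ?mul0r.
Qed.

(** The excess of red edges over the first summand of the conclusion is summed over all [x]. If it
    were below [a e / (2mD)] for each [x] outside [X], the total would be at most (1/8 + 1/2)
    [a e |A| / (mD)], the 1/8 bounding the contribution of [X]; but it is at least 3/4 of that
    quantity. *)
Lemma red_step (L : B -> C -> bool) (Y : {set B}) (Z : {set C}) (X : {set A}) :
  let e := edge_count R L Y Z in
  (forall y z, L y z -> K y z) -> 0 < e ->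
  (forall (Y' : {set B}) (Z' : {set C}), Y' \subset Y -> Z' \subset Z ->
    potential R (8 * (m * D)) L Y' Z' <= potential R (8 * (m * D)) L Y Z) ->
  (8 * m * D * #|X|)%:R <= a * #|A|%:R ->
  exists2 x, x \notin X &
    let Yx := Y :&: [set y | g x y] in
    let Zx := Z :&: [set z | h x z] in
    a * (1 - m%:R^-1) * (e / (#|Y|%:R * #|Z|%:R)) * (#|Yx|%:R * #|Zx|%:R) +
    a * e / (2 * m * D)%:R <=
    edge_count R (fun y z => L y z && red x y z) Yx Zx.
Proof.
move=> e LK e_gt0 maxYZ X_small.
pose Yx x := Y :&: [set y | g x y]; pose Zx x := Z :&: [set z | h x z].
pose ex x := edge_count R L (Yx x) (Zx x).
pose er x := edge_count R (fun y z => L y z && red x y z) (Yx x) (Zx x).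
pose lam := e / (#|Y|%:R * #|Z|%:R).
have m0 : 0 < m%:R :> R by rewrite ltr0n.
have D0 : 0 < D%:R :> R by rewrite ltr0n.
have n0 : 0 < #|A|%:R :> R by rewrite ltr0n.
(* A red triple makes [y] and [z] neighbours of [x], so the restriction to [Yx] and [Zx] loses no
   edge. *)
have erE x : er x = edge_count R (fun y z => L y z && red x y z) Y Z.
  rewrite /er edge_count_restrict; apply: eq_bigr => y _; apply: eq_bigr => z _.
  by case: (L y z) => //=; case: (boolP (red x y z)) => //= /red_gh ->.
have sum_ex : e * (#|A|%:R / D%:R) <= \sum_x ex x.
  under eq_bigr => x _ do rewrite /ex edge_count_restrict.
  rewrite (sum_edge_count_and (fun x y z => g x y && h x z)).
  rewrite mulr_suml; apply: ler_sum => y _.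
  rewrite mulr_suml; apply: ler_sum => z _.
  case: (boolP (L y z)) => [/LK/K_codegree H|]; rewrite ?mul0r // !mul1r.
  by rewrite ler_pdivrMr // mulrC.
have sum_er : a * \sum_x ex x <= \sum_x er x.
  under [X in _ * X]eq_bigr => x _ do rewrite /ex edge_count_restrict.
  under [X in _ <= X]eq_bigr => x _ do rewrite erE.
  rewrite (sum_edge_count_and (fun x y z => g x y && h x z)).
  rewrite (sum_edge_count_and red).
  rewrite mulr_sumr; apply: ler_sum => y _.
  rewrite mulr_sumr; apply: ler_sum => z _.
  by case: (boolP (L y z)) => [/LK/K_red|]; rewrite ?mul1r // !mul0r mulr0.
have E_gt0 : (0 < 8 * (m * D))%N by rewrite !muln_gt0 D_gt0 m_gt0.
(* With [E = 8mD], the error [2e/E] of [maximal_pair_lower] is [e / (4mD)]. *)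
have lower x : lam * (#|Yx x|%:R * #|Zx x|%:R) <= ex x + e / (4 * m * D)%:R.
  have := maximal_pair_lower E_gt0 e_gt0 maxYZ (subsetIl Y [set y | g x y])
    (subsetIl Z [set z | h x z]).
  rewrite -/e -/lam lerBlDr => /le_trans; apply; rewrite lerD2l.
  by rewrite le_eqVlt; apply/orP; left; apply/eqP; rewrite !natrM; field; rewrite !gt_eqF.
pose d x := er x - a * (1 - m%:R^-1) * lam * (#|Yx x|%:R * #|Zx x|%:R).
pose w := a * e / (2 * m * D)%:R.
have m1 : 0 <= 1 - m%:R^-1 :> R by rewrite subr_ge0 invf_le1 // ler1n.
have lam0 : 0 <= lam by rewrite divr_ge0 ?mulr_ge0 // ltW.
(* The factor [1 - 1/m] sets free [a/m] times the sum of [ex], which is at least [a e |A| / (mD)]; a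
   quarter of this pays for the errors in [lower]. *)
have sum_d : a * e * #|A|%:R / (m * D)%:R * (3 / 4) <= \sum_x d x.
  rewrite /d sumrB; set T := (X in _ <= _ - X).
  move: sum_er; set S := \sum_x er x => sum_er.
  have : T <= a * (1 - m%:R^-1) * (\sum_x ex x + e / (4 * m * D)%:R * #|A|%:R).
    have -> : e / (4 * m * D)%:R * #|A|%:R = \sum_(x : A) e / (4 * m * D)%:R.
      by rewrite sumr_const mulr_natr.
    rewrite -big_split mulr_sumr; apply: ler_sum => x _ /=.
    have := ler_wpM2l (mulr_ge0 (ltW a_gt0) m1) (lower x).
    by rewrite /ex !mulrA.
  have := ler_wpM2l (ltW a_gt0) sum_ex.
  move: sum_er; set U := \sum_x ex x; rewrite !natrM => + ue.
  have am : 0 <= a / m%:R by rewrite divr_ge0 // ltW.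
  have : 0 <= a / m%:R * (U - e * (#|A|%:R / D%:R)).
    by rewrite mulr_ge0 // subr_ge0; move: ue; rewrite ler_pM2l.
  have : 0 <= a / m%:R * (e / (4 * m%:R * D%:R) * #|A|%:R).
    by rewrite mulr_ge0 // mulr_ge0 ?divr_ge0 ?mulr_ge0 // ltW.
  have -> : a * e * #|A|%:R / (m%:R * D%:R) * (3 / 4) =
    a / m%:R * (e * (#|A|%:R / D%:R)) - a * (e / (4 * m%:R * D%:R) * #|A|%:R).
    by field; rewrite !gt_eqF.
  by lra.
case: (pselect (exists2 x, x \notin X & w <= d x)) => [[x xX dx]|no_x].
  by exists x => //=; move: dx; rewrite /d /w lerBrDl.
exfalso.
have d_le x : d x <= (if x \in X then e else w).
  case: ifPn => xX; last first.
    by rewrite leNgt; apply/negP => /ltW H; apply: no_x; exists x.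
  rewrite /d erE lerBlDr; apply: ler_wpDr.
    apply: mulr_ge0; last by rewrite mulr_ge0 ?ler0n.
    exact: mulr_ge0 (mulr_ge0 (ltW a_gt0) m1) lam0.
  apply: ler_sum => y _; apply: ler_sum => z _.
  by rewrite ler_nat; case: (L y z); case: (red x y z).
have w_gt0 : 0 < w by rewrite /w divr_gt0 ?mulr_gt0 // ltr0n !muln_gt0 D_gt0 m_gt0.
have sum_le : \sum_x d x <= e * #|X|%:R + w * #|A|%:R.
  apply: (@le_trans _ _ (\sum_x ((if x \in X then e else 0) + w))).
    by apply: ler_sum => x _; apply: le_trans (d_le x) _; case: ifP; rewrite ?lerDl ?add0r // ltW.
  by rewrite big_split /= -big_mkcond /= !sumr_const !mulr_natr.
have := le_trans sum_d sum_le.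
have eX : e * #|X|%:R <= a * e * #|A|%:R / (m * D)%:R / 8.
  rewrite -!(mulrA _ _^-1) -invfM ler_pdivlMr; last first.
    by rewrite mulr_gt0 // ltr0n muln_gt0 m_gt0.
  move: X_small; rewrite -(ler_pM2l e_gt0) !natrM; lra.
have H : 0 < a * e * #|A|%:R / (m * D)%:R by rewrite divr_gt0 ?mulr_gt0 // ltr0n muln_gt0 m_gt0.
have -> : w * #|A|%:R = a * e * #|A|%:R / (m * D)%:R / 2.
  by rewrite /w !natrM; field; rewrite !gt_eqF.
by move: eX; lra.
Qed.
End RedStep.

(** * Complete bipartite subgraphs of dense bipartite graphs *)

Lemma edge_count_gt_ex (R : realFieldType) (B C : finType)
    (L : B -> C -> bool) (Y : {set B}) (Z : {set C}) (c : R) :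
  c * #|Y|%:R < edge_count R L Y Z ->
  exists2 y, y \in Y & c < #|[set z in Z | L y z]|%:R.
Proof.
move=> lt_e; case: (pselect (exists2 y, y \in Y & c < #|[set z in Z | L y z]|%:R)) => // noy.
exfalso; move: lt_e; rewrite ltNge => /negP; apply.
rewrite mulr_natr -sumr_const; apply: ler_sum => y yY.
have -> : \sum_(z in Z) (L y z)%:R = #|[set z in Z | L y z]|%:R :> R.
  rewrite -sum_indicator [LHS]big_mkcond.
  by apply: eq_bigr => z _; case: (z \in Z).
by rewrite leNgt; apply/negP => H; apply: noy; exists y.
Qed.

Lemma edge_count_flip (R : realFieldType) (B C : finType)
    (L : B -> C -> bool) (Y : {set B}) (Z : {set C}) :
  edge_count R L Y Z = edge_count R (fun z y => L y z) Z Y.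
Proof. exact: exchange_big. Qed.

Lemma edge_count_row_ge (R : realFieldType) (B C : finType)
    (L : B -> C -> bool) (Y : {set B}) (Z : {set C}) (c : R) :
  (forall z, z \in Z -> c <= #|[set y in Y | L y z]|%:R) ->
  c * #|Z|%:R <= edge_count R L Y Z.
Proof.
move=> H; rewrite edge_count_flip mulr_natr -sumr_const; apply: ler_sum => z /H.
move=> /le_trans; apply; rewrite -sum_indicator [leRHS]big_mkcond.
by apply: ler_sum => y _; case: (y \in Y).
Qed.

(** The set [Z0] of vertices of degree at least half the average guaranteed by [lam] has size at
    least [lam/4] times |Z|. The set [S] is then built greedily: since [4s <= lam |Y|], every vertex
    of [T] still has more than [lam |Y| / 4] neighbours outside [S], so some new [y] is joined to
    more than a fraction [lam/4] of [T]. *)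
Lemma complete_bipartite_of_dense (R : realFieldType) (B C : finType)
    (L : B -> C -> bool) (Y : {set B}) (Z : {set C}) (s : nat) (lam : R) :
  (0 < s)%N -> 0 < lam ->
  lam * (#|Y|%:R * #|Z|%:R) <= edge_count R L Y Z ->
  4 * s%:R <= lam * #|Y|%:R -> s%:R <= (lam / 4) ^+ s.+1 * #|Z|%:R ->
  exists (S : {set B}) (T : {set C}),
    [/\ S \subset Y, T \subset Z, #|S| = s, (s <= #|T|)%N &
        {in S & T, forall y z, L y z}].
Proof.
move=> s0 lam0 e_ge Y_ge Z_ge.
have s0R : 0 < s%:R :> R by rewrite ltr0n.
have l4 : 0 < lam / 4 by rewrite divr_gt0.
have Y0 : 0 < #|Y|%:R :> R.
  by rewrite -(pmulr_rgt0 _ lam0); apply: lt_le_trans Y_ge; rewrite mulr_gt0.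
pose Z0 := [set z in Z | lam / 2 * #|Y|%:R <= #|[set y in Y | L y z]|%:R].
have Z0_ge : lam / 4 * #|Z|%:R <= #|Z0|%:R.
  have sub : Z0 \subset Z by apply/subsetP => z; rewrite inE => /andP[].
  have : edge_count R L Y Z <= #|Y|%:R * #|Z0|%:R + lam / 2 * #|Y|%:R * #|Z|%:R.
    rewrite (edge_count_splitr R L Y sub); apply: lerD; first exact: edge_count_le.
    rewrite leNgt; apply/negP; rewrite edge_count_flip => H.
    have : lam / 2 * #|Y|%:R * #|Z :\: Z0|%:R < edge_count R (fun z y => L y z) (Z :\: Z0) Y.
      apply: le_lt_trans H; apply: ler_wpM2l; first by rewrite mulr_ge0 ?divr_ge0 // ltW.
      by rewrite ler_nat subset_leq_card // subsetDl.
    case/edge_count_gt_ex => z; rewrite !inE => /andP[nz zZ] /ltW lt2.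
    by rewrite zZ lt2 in nz.
  move=> le2; have := le_trans e_ge le2.
  have -> : lam * (#|Y|%:R * #|Z|%:R) = #|Y|%:R * (lam * #|Z|%:R) by ring.
  have -> : lam / 2 * #|Y|%:R * #|Z|%:R = #|Y|%:R * (lam / 2 * #|Z|%:R) by ring.
  rewrite -mulrDr ler_pM2l //.
  have : 0 <= lam * #|Z|%:R by rewrite mulr_ge0 // ltW.
  lra.
suff H i : (i <= s)%N -> exists (S : {set B}) (T : {set C}),
    [/\ S \subset Y, T \subset Z0, #|S| = i, (lam / 4) ^+ i * #|Z0|%:R <= #|T|%:R &
        {in S & T, forall y z, L y z}].
  have [S [T [SY TZ cS cT ST]]] := H s (leqnn s).
  exists S, T; split => //.
    by apply: subset_trans TZ _; apply/subsetP => z; rewrite inE => /andP[].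
  rewrite -(ler_nat R); apply: le_trans cT; apply: le_trans Z_ge _.
  by rewrite exprSr -mulrA ler_wpM2l // exprn_ge0 // ltW.
elim: i => [_|i IH lt_is].
  exists set0, Z0; rewrite sub0set subxx cards0 expr0 mul1r; split => //.
  by move=> y z; rewrite inE.
have [S [T [SY TZ cS cT ST]]] := IH (ltnW lt_is).
have Zpos : 0 < #|Z0|%:R :> R.
  apply: lt_le_trans Z0_ge; rewrite mulr_gt0 //.
  rewrite -(pmulr_rgt0 _ (exprn_gt0 s.+1 l4)).
  exact: lt_le_trans Z_ge.
have T0 : 0 < #|T|%:R :> R.
  by apply: lt_le_trans cT; rewrite mulr_gt0 // exprn_gt0.
have deg z : z \in T -> lam / 2 * #|Y|%:R - i%:R <= #|[set y in Y :\: S | L y z]|%:R.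
  move=> zT; have : z \in Z0 by apply: (subsetP TZ).
  rewrite inE => /andP[_ H]; rewrite lerBlDr; apply: le_trans H _.
  rewrite -natrD ler_nat -cS.
  rewrite (leq_trans _ (leq_card_setU _ _)) //; apply: subset_leq_card.
  apply/subsetP => y; rewrite !inE => /andP[-> ->].
  by case: (y \in S).
have := edge_count_row_ge deg.
have lt1 : lam / 4 * #|T|%:R * #|Y :\: S|%:R < (lam / 2 * #|Y|%:R - i%:R) * #|T|%:R.
  rewrite mulrAC ltr_pM2r //.
  apply: (@le_lt_trans _ _ (lam / 4 * #|Y|%:R)).
    by rewrite ler_pM2l // ler_nat subset_leq_card // subsetDl.
  have : i%:R < s%:R :> R by rewrite ltr_nat.
  move: Y_ge; lra.
move=> /(lt_le_trans lt1)/edge_count_gt_ex[y]; rewrite !inE => /andP[yS yY] ydeg.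
exists (y |: S), [set z in T | L y z]; split.
- by rewrite subUset sub1set yY.
- by apply: subset_trans TZ; apply/subsetP => z; rewrite inE => /andP[].
- by rewrite cardsU1 yS cS.
- rewrite exprS -mulrA; apply: le_trans (ltW ydeg).
  by rewrite ler_pM2l.
- move=> y' z; rewrite !inE => /orP[/eqP -> /andP[] // | y'S /andP[zT _]].
  exact: ST.
Qed.

(** * Iterated choice of the vertices of the first part *)

Section RedIteration.
Variables (R : realFieldType) (A B C : finType).
Variables (g : A -> B -> bool) (h : A -> C -> bool) (red : A -> B -> C -> bool).
Hypothesis red_gh : forall x y z, red x y z -> g x y && h x z.
Variables (K : B -> C -> bool) (a : R) (D m s : nat).
Hypotheses (D_gt0 : (0 < D)%N) (m_gt1 : (1 < m)%N) (s_gt0 : (0 < s)%N).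
Hypotheses (a_gt0 : 0 < a) (a_le1 : a <= 1) (A_gt0 : (0 < #|A|)%N).
Hypothesis K_red : forall y z, K y z ->
  a * #|[set x | g x y && h x z]|%:R <= #|[set x | red x y z]|%:R.
Hypothesis K_codegree : forall y z, K y z ->
  #|A|%:R <= D%:R * #|[set x | g x y && h x z]|%:R :> R.
Hypotheses (B_gt0 : (0 < #|B|)%N) (C_gt0 : (0 < #|C|)%N).
Hypothesis K_dense :
  D%:R^-1 * (#|B|%:R * #|C|%:R) <= edge_count R K [set: B] [set: C].
Hypothesis A_large : (8 * m * D * s)%:R <= a * #|A|%:R.

Let b := a * (1 - m%:R^-1).
Let E := (8 * (m * D))%N.
(* One step multiplies |Y||Z| by at least [a * lam / (2 * m * D)], where
   [lam >= b ^+ s / D] is the density, and [lam ^+ E] by at least [b ^+ E]. *)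
Let tau := a * (b ^+ s / D%:R) / (2 * m * D)%:R * b ^+ E.
Let common_red (X : {set A}) y z := K y z && [forall x in X, red x y z].

(** Two invariants are carried along: the density of the common red graph and its potential. The
    potential serves as a lower bound for |Y||Z|, and it can only grow when a maximal pair is taken
    before each application of [red_step]. *)
Lemma red_iteration i : (i <= s)%N -> exists (X : {set A}) (Y : {set B}) (Z : {set C}),
  [/\ #|X| = i, 0 < edge_count R (common_red X) Y Z,
      b ^+ i / D%:R * (#|Y|%:R * #|Z|%:R) <= edge_count R (common_red X) Y Z &
      tau ^+ i * (#|B|%:R * #|C|%:R / D%:R ^+ E)
        <= potential R E (common_red X) Y Z].
Proof.
have m_gt0 : (0 < m)%N by exact: ltnW.
have D0 : 0 < D%:R :> R by rewrite ltr0n.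
have m0 : 0 < m%:R :> R by rewrite ltr0n.
have E_gt0 : (0 < E)%N by rewrite !muln_gt0 D_gt0 m_gt0.
have b_gt0 : 0 < b by rewrite mulr_gt0 // subr_gt0 invf_lt1 // ltr1n.
have b_le1 : b <= 1.
  by rewrite mulr_ile1 ?(ltW a_gt0) // ?subr_ge0 ?invf_le1 ?ler1n // gerBl invr_ge0 ltW.
have BC0 : 0 < #|B|%:R * #|C|%:R :> R by rewrite mulr_gt0 // ltr0n.
have tau_gt0 : 0 < tau.
  by rewrite !mulr_gt0 ?invr_gt0 ?exprn_gt0 // ltr0n !muln_gt0 m_gt0.
elim: i => [_|i IH lt_is].
  have e_ge : D%:R^-1 * (#|B|%:R * #|C|%:R) <= edge_count R (common_red set0) [set: B] [set: C].
    apply: le_trans K_dense _; apply: ler_sum => y _; apply: ler_sum => z _.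
    rewrite ler_nat /common_red; case: (K y z) => //=.
    by rewrite lt0b; apply/forall_inP => x; rewrite inE.
  exists set0, setT, setT; rewrite cards0 !cardsT !expr0 !mul1r; split => //.
    by apply: lt_le_trans e_ge; rewrite mulr_gt0 ?invr_gt0.
  rewrite /potential !cardsT ler_pdivlMr ?exprn_gt0 //.
  have -> : #|B|%:R * #|C|%:R / D%:R ^+ E * (#|B|%:R * #|C|%:R) ^+ E.-1 =
      (D%:R^-1 * (#|B|%:R * #|C|%:R)) ^+ E :> R.
    by rewrite [RHS]exprMn exprVn [LHS]mulrAC -exprS prednK // mulrC.
  by rewrite lerXn2r // ?nnegrE ?edge_count_ge0 // mulr_ge0 ?invr_ge0 // ltW.
have [X [Y0 [Z0 [cX e0_gt0 e0_ge pot0]]]] := IH (ltnW lt_is).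
have [Y [Z [YY0 ZZ0 pot_le dens maxYZ]]] := potential_max E_gt0 e0_gt0.
set L := common_red X in e0_gt0 e0_ge pot0 pot_le dens maxYZ.
have s0_gt0 := lt_le_trans e0_gt0 (edge_count_le R L Y0 Z0).
have e_gt0 : 0 < edge_count R L Y Z.
  rewrite lt_def edge_count_ge0 andbT; apply: contraTneq pot_le => eq0.
  rewrite -ltNge /potential eq0 expr0n eqn0Ngt E_gt0 mul0r.
  by rewrite divr_gt0 ?exprn_gt0.
have s_gt := lt_le_trans e_gt0 (edge_count_le R L Y Z).
pose lam := edge_count R L Y Z / (#|Y|%:R * #|Z|%:R).
have lam_ge : b ^+ i / D%:R <= lam.
  rewrite ler_pdivlMr // -(ler_pM2r s0_gt0); apply: le_trans dens.
  by rewrite mulrAC ler_pM2r.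
have lam_gt0 : 0 < lam by rewrite divr_gt0.
have lamE : lam * (#|Y|%:R * #|Z|%:R) = edge_count R L Y Z.
  by rewrite mulfVK // gt_eqF.
have X_small : (8 * m * D * #|X|)%:R <= a * #|A|%:R.
  by apply: le_trans A_large; rewrite ler_nat leq_mul // cX ltnW.
have LK y z : L y z -> K y z by case/andP.
have [x xX /=] := red_step red_gh D_gt0 m_gt0 a_gt0 A_gt0 K_red K_codegree
  LK e_gt0 maxYZ X_small.
rewrite -/b -/lam.
set Y' := Y :&: _; set Z' := Z :&: _.
have -> : edge_count R (fun y z => L y z && red x y z) Y' Z' =
  edge_count R (common_red (x |: X)) Y' Z'.
  apply: eq_bigr => y _; apply: eq_bigr => z _; congr (nat_of_bool _)%:R.
  rewrite /L /common_red -andbA; congr (_ && _).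
  apply/andP/forall_inP => [[/forall_inP H rx] x'|H].
    by rewrite !inE => /orP[/eqP -> //|/H].
  split; last by apply: H; rewrite setU11.
  by apply/forall_inP => x' x'X; apply: H; rewrite inE x'X orbT.
set e' := edge_count R _ Y' Z'; set s' := #|Y'|%:R * #|Z'|%:R => e'_ge.
have w_gt0 : 0 < a * edge_count R L Y Z / (2 * m * D)%:R.
  by rewrite divr_gt0 ?mulr_gt0 // ltr0n !muln_gt0 m_gt0.
have s'_ge0 : 0 <= s' by rewrite mulr_ge0.
have e'_gt0 : 0 < e'.
  by apply: lt_le_trans e'_ge; rewrite ltr_wpDl // mulr_ge0 // mulr_ge0 // ltW.
have e's' : e' <= s' by apply: edge_count_le.
have s'_gt0 := lt_le_trans e'_gt0 e's'.
(* The two summands provided by [red_step] are used separately: the first keeps the density, the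
   second bounds the size [s'] from below. *)
have e'_ge1 : b * lam * s' <= e'.
  by apply: le_trans e'_ge; rewrite lerDl ltW.
have s'_ge : a * edge_count R L Y Z / (2 * m * D)%:R <= s'.
  by apply: le_trans e's'; apply: le_trans e'_ge; rewrite lerDr mulr_ge0 // mulr_ge0 // ltW.
exists (x |: X), Y', Z'; split => //.
- by rewrite cardsU1 xX cX.
- apply: le_trans e'_ge1; apply: ler_wpM2r => //.
  by rewrite exprS -mulrA ler_pM2l.
- rewrite exprS -mulrA.
  apply: (@le_trans _ _ (tau * potential R E L Y Z)).
    by rewrite ler_pM2l //; apply: le_trans pot_le.
  have -> : potential R E L Y Z = lam ^+ E * (#|Y|%:R * #|Z|%:R).
    rewrite /potential -lamE exprMn -{2}(prednK E_gt0) exprS -!mulrA; congr (_ * _).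
    by rewrite divff ?mulr1 // expf_neq0 // gt_eqF.
  rewrite /potential ler_pdivlMr ?exprn_gt0 // -/e' -/s'.
  (* Divided by [s'^(E-1)], this leaves [(b lam)^E s'], to be compared with the old potential
     [lam^E |Y||Z|]. *)
  apply: (@le_trans _ _ ((b * lam * s') ^+ E)); last first.
    have bls_ge0 : 0 <= b * lam * s' by exact: mulr_ge0 (mulr_ge0 (ltW b_gt0) (ltW lam_gt0)) s'_ge0.
    by rewrite lerXn2r // ?nnegrE // ltW.
  have -> : (b * lam * s') ^+ E = b ^+ E * lam ^+ E * s' * s' ^+ E.-1.
    have s'E : s' ^+ E = s' * s' ^+ E.-1 by rewrite -exprS prednK.
    by rewrite exprMn s'E exprMn mulrA.
  apply: ler_wpM2r; first by rewrite exprn_ge0.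
  have -> : tau * (lam ^+ E * (#|Y|%:R * #|Z|%:R)) =
    b ^+ E * lam ^+ E * (a * (b ^+ s / D%:R * (#|Y|%:R * #|Z|%:R)) / (2 * m * D)%:R).
    by rewrite /tau; ring.
  apply: ler_wpM2l; first by rewrite mulr_ge0 // exprn_ge0 // ltW.
  apply: le_trans s'_ge; rewrite ler_pM2r ?invr_gt0 ?ltr0n ?muln_gt0 ?m_gt0 //.
  rewrite ler_pM2l // -lamE ler_pM2r //; apply: le_trans lam_ge.
  by rewrite ler_pM2r ?invr_gt0 // ler_wiXn2l ?(ltW b_gt0) // ltnW.
Qed.

(** The potential is at most |Y||Z|, so [red_iteration] bounds this product below; as neither set
    exceeds [N], each is at least [tau^s N / D^E]. This is enough to find a complete bipartite graph
    at density [b^s / D]. *)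
Lemma red_complete_tripartite (N : R) :
  #|B|%:R = N -> #|C|%:R = N ->
  4 * s%:R * D%:R ^+ E.+1 <= b ^+ s * tau ^+ s * N ->
  s%:R * D%:R ^+ E <= (b ^+ s / (4 * D%:R)) ^+ s.+1 * tau ^+ s * N ->
  exists (X : {set A}) (Y : {set B}) (Z : {set C}),
    [/\ (s <= #|X|)%N, (s <= #|Y|)%N, (s <= #|Z|)%N &
       forall x y z, x \in X -> y \in Y -> z \in Z -> red x y z].
Proof.
move=> BN CN large1 large2.
have [X [Y [Z [cX e_gt0 e_ge pot]]]] := red_iteration (leqnn s).
have m_gt0 : (0 < m)%N by exact: ltnW.
have D0 : 0 < D%:R :> R by rewrite ltr0n.
have m0 : 0 < m%:R :> R by rewrite ltr0n.
have E_gt0 : (0 < E)%N by rewrite !muln_gt0 D_gt0 m_gt0.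
have b_gt0 : 0 < b by rewrite mulr_gt0 // subr_gt0 invf_lt1 // ltr1n.
have s_gt := lt_le_trans e_gt0 (edge_count_le R _ Y Z).
have N0 : 0 < N by rewrite -BN ltr0n.
have YZ_ge : tau ^+ s * (N * N) <= #|Y|%:R * #|Z|%:R * D%:R ^+ E.
  rewrite -ler_pdivrMr ?exprn_gt0 // -mulrA -{1}BN -CN.
  apply: le_trans pot _; rewrite /potential ler_pdivrMr ?exprn_gt0 // -exprS prednK //.
  by rewrite lerXn2r ?nnegrE ?edge_count_ge0 ?edge_count_le // ltW.
have Y_ge : tau ^+ s * N <= #|Y|%:R * D%:R ^+ E.
  rewrite -(ler_pM2r N0) -mulrA; apply: le_trans YZ_ge _.
  rewrite [leRHS]mulrAC; apply: ler_wpM2r; first by rewrite exprn_ge0.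
  by apply: ler_wpM2l => //; rewrite -CN ler_nat max_card.
have Z_ge : tau ^+ s * N <= #|Z|%:R * D%:R ^+ E.
  rewrite -(ler_pM2r N0) -mulrA; apply: le_trans YZ_ge _.
  rewrite -mulrA [leLHS]mulrC; apply: ler_wpM2l; first by rewrite mulr_ge0 ?exprn_ge0.
  by rewrite -BN ler_nat max_card.
have lam0 : 0 < b ^+ s / D%:R by rewrite divr_gt0 ?exprn_gt0.
have DE0 : 0 < D%:R ^+ E :> R by rewrite exprn_gt0.
have bs0 : 0 < b ^+ s by rewrite exprn_gt0.
have l1 : 4 * s%:R <= b ^+ s / D%:R * #|Y|%:R.
  rewrite mulrAC ler_pdivlMr // -(ler_pM2r DE0).
  move: large1; rewrite exprS mulrA => /le_trans; apply.
  by rewrite -!mulrA ler_pM2l.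
have l2 : s%:R <= (b ^+ s / D%:R / 4) ^+ s.+1 * #|Z|%:R.
  rewrite -(ler_pM2r DE0); apply: le_trans large2 _.
  rewrite -mulrA -mulrA -invfM [4 * _]mulrC -!mulrA ler_pM2l //.
  by rewrite exprn_gt0 // divr_gt0 // mulr_gt0.
have [S [T [_ _ cS cT ST]]] := complete_bipartite_of_dense s_gt0 lam0 e_ge l1 l2.
exists X, S, T; rewrite cX cS; split => // x y z xX yS zT.
by have /andP[_ /forall_inP] := ST y z yS zT; apply.
Qed.
End RedIteration.

(** * Pairs of large codegree in mostly red triangles *)

(** Edges of [k] with too many blue triangles carry at most half of the triangles, and those of
    codegree below |A|/D at most a quarter. The remaining edges carry at least a quarter, each at
    most |A| triangles. *)
Lemma dense_pairs (R : realFieldType) (A B C : finType) (g : A -> B -> bool)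
    (h : A -> C -> bool) (k : B -> C -> bool) (blue : A -> B -> C -> bool)
    (rho : R) (D : nat) :
  let triangles := \sum_x \sum_y \sum_z (k y z && (g x y && h x z))%:R in
  let codegree y z := #|[set x | g x y && h x z]|%:R : R in
  let red_degree y z :=
    #|[set x | g x y && h x z && ~~ blue x y z]|%:R : R in
  0 < rho -> (0 < D)%N -> (0 < #|A|)%N ->
  \sum_x \sum_y \sum_z (k y z && (g x y && h x z && blue x y z))%:R <=
    2 * rho * triangles ->
  4 / D%:R * (#|A|%:R * #|B|%:R * #|C|%:R) <= triangles ->
  D%:R^-1 * (#|B|%:R * #|C|%:R) <= edge_count R
    (fun y z => [&& k y z, (1 - 4 * rho) * codegree y z <= red_degree y z
                 & #|A|%:R <= D%:R * codegree y z]) [set: B] [set: C].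
Proof.
move=> T codeg rdeg rho0 D0' A0' blueT Tlarge.
have D0 : 0 < D%:R :> R by rewrite ltr0n.
have A0 : 0 < #|A|%:R :> R by rewrite ltr0n.
set K := (X in edge_count _ X).
have sumE (P : A -> B -> C -> bool) : \sum_x \sum_y \sum_z (k y z && P x y z)%:R =
    \sum_y \sum_z (k y z)%:R * #|[set x | P x y z]|%:R :> R.
  rewrite exchange_big; apply: eq_bigr => y _.
  rewrite exchange_big; apply: eq_bigr => z _.
  rewrite -sum_indicator mulr_sumr; apply: eq_bigr => x _.
  by case: (k y z); rewrite ?mul1r ?mul0r.
pose bdeg y z : R := #|[set x | g x y && h x z && blue x y z]|%:R.
have codegE y z : codeg y z = rdeg y z + bdeg y z.
  rewrite /codeg /rdeg /bdeg -!sum_indicator -big_split; apply: eq_bigr => x _ /=.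
  by case: (g x y && h x z); case: (blue x y z); rewrite /= ?addr0 ?add0r.
have TE : T = \sum_y \sum_z (k y z)%:R * codeg y z.
  exact: (sumE (fun x y z => g x y && h x z)).
move: blueT; rewrite (sumE (fun x y z => g x y && h x z && blue x y z)).
set U := \sum_y _ => blueT.
have point y z : (k y z)%:R * codeg y z <=
    #|A|%:R * (K y z)%:R + (k y z)%:R * bdeg y z / (4 * rho) + #|A|%:R / D%:R.
  have b0 : 0 <= bdeg y z by exact: ler0n.
  have r0 : 0 <= rdeg y z by exact: ler0n.
  have AD0 : 0 <= #|A|%:R / D%:R :> R by rewrite divr_ge0.
  have br0 : 0 <= bdeg y z / (4 * rho) by rewrite divr_ge0 // mulr_ge0 // ltW.
  have KA0 : 0 <= #|A|%:R * (K y z)%:R :> R by rewrite mulr_ge0.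
  rewrite -(mulrA _ (bdeg y z)).
  case: (boolP (k y z)) => kyz; rewrite ?mul0r ?mul1r; last by rewrite addr0 addr_ge0.
  have : codeg y z <= #|A|%:R by rewrite ler_nat max_card.
  case: (boolP (K y z)) => [_ | ]; first by rewrite mulr1; lra.
  rewrite /K kyz /= negb_and -!ltNge mulr0 add0r => /orP[lt1|lt1] _.
  - apply: ler_wpDr => //; rewrite ler_pdivlMr ?mulr_gt0 //.
    by move: lt1; rewrite codegE; lra.
  - apply: ler_wpDl => //; rewrite ler_pdivlMr // mulrC; exact: ltW.
have sum_point : T <= #|A|%:R * edge_count R K setT setT + U / (4 * rho) +
    #|A|%:R / D%:R * (#|B|%:R * #|C|%:R).
  have -> : #|A|%:R / D%:R * (#|B|%:R * #|C|%:R) =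
      \sum_(y : B) \sum_(z : C) #|A|%:R / D%:R :> R.
    by rewrite !sumr_const -mulrnA -[RHS]mulr_natr natrM [in RHS](mulrC #|C|%:R).
  rewrite TE /edge_count /U mulr_sumr mulr_suml.
  under [X in X + _ + _]eq_bigl => y do rewrite in_setT.
  rewrite -!big_split; apply: ler_sum => y _ /=.
  under [in X in X + _ + _]eq_bigl => z do rewrite in_setT.
  rewrite mulr_sumr mulr_suml -!big_split; apply: ler_sum => z _ /=.
  exact: point.
have {}blueT : U / (4 * rho) <= T / 2.
  by rewrite ler_pdivrMr ?mulr_gt0 //; move: blueT; lra.
rewrite -(ler_pM2l A0).
have -> : #|A|%:R * (D%:R^-1 * (#|B|%:R * #|C|%:R)) =
  #|A|%:R / D%:R * (#|B|%:R * #|C|%:R) :> R by ring.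
have : 4 / D%:R * (#|A|%:R * #|B|%:R * #|C|%:R) =
  4 * (#|A|%:R / D%:R * (#|B|%:R * #|C|%:R)) :> R by ring.
by move: Tlarge sum_point blueT; lra.
Qed.

(** * Placements of the blue hypergraph *)

Lemma sorted_enum_ord t (e : {set 'I_t}) : sorted (fun i j : 'I_t => (i < j)%N) (enum e).
Proof.
rewrite {1}/enum_mem -enumT; apply: sorted_filter; first by move=> i j k; apply: ltn_trans.
have := iota_ltn_sorted 0 t; rewrite -val_enum_ord sorted_map; exact.
Qed.
Lemma card3_sorted t (e : {set 'I_t}) : #|e| = 3%N ->
  exists a b c : 'I_t, [/\ (a < b)%N, (b < c)%N & e = [set a; b; c]].
Proof.
move=> ce; have := sorted_enum_ord e; have : size (enum e) = 3%N by rewrite -cardE.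
have := mem_enum e; case: (enum e) => [|a [|b [|c []]]] //= mem_e _ /and3P[ab bc _].
exists a, b, c; split => //; apply/setP => j.
by rewrite -mem_e !inE orbA.
Qed.
Section LocalConstraints.
Variables (R : realFieldType) (t n : nat).
Local Notation point := {ffun 'I_t -> 'I_n}.
Variable ok : {set 'I_t} -> point -> bool.
Hypothesis ok_local : forall (e : {set 'I_t}) (y y' : point),
  {in e, forall j, y j = y' j} -> ok e y = ok e y'.
Implicit Types (F G : {set {set 'I_t}}) (y : point).

Definition satisfies F y := [forall e in F, ok e y].
(** A count in place of a probability: ratios of such counts are the conditional probabilities for a
    uniform placement. *)
Definition solutions F : R := #|[set y | satisfies F y]|%:R.

Lemma satisfiesU1 e F y : satisfies (e |: F) y = satisfies F y && ok e y.
Proof.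
apply/forall_inP/andP => [H | [/forall_inP H oke] f].
  split; last by apply: H; rewrite setU11.
  by apply/forall_inP => f fF; apply: H; rewrite inE fF orbT.
by rewrite !inE => /orP[/eqP -> //|/H].
Qed.

(** The members of [F] outside [G] are added one at a time; each set before an addition is a proper
    subset of [F], so each addition costs one factor [rho]. *)
Lemma solutions_chain (rho : R) F : 0 <= rho ->
  (forall F' e, F' \proper F -> e \in F :\: F' ->
    rho * solutions F' <= solutions (e |: F')) ->
  forall G, G \subset F -> rho ^+ #|F :\: G| * solutions G <= solutions F.
Proof.
move=> rho0 step G; move cG: #|F :\: G| => k.
elim: k G cG => [|k IH] G cG GF.
  move/eqP: cG; rewrite cards_eq0 setD_eq0 expr0 mul1r => FG.
  by have /eqP -> : G == F by rewrite eqEsubset GF.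
have [e eFG] : exists e, e \in F :\: G.
  by apply/set0Pn; rewrite -card_gt0 cG.
have [eF eG] : e \in F /\ e \notin G by move: eFG; rewrite inE => /andP[].
have GpF : G \proper F by rewrite properE GF; apply/subsetPn; exists e.
have cG' : #|F :\: (e |: G)| = k.
  apply: succn_inj; rewrite -cG (cardsD1 e (F :\: G)) eFG /= add1n.
  by congr _.+1; apply: eq_card => f; rewrite !inE negb_or andbA.
have sub : e |: G \subset F by rewrite subUset sub1set eF.
apply: le_trans (IH _ cG' sub); rewrite exprSr -mulrA.
by rewrite ler_wpM2l ?exprn_ge0 // step.
Qed.

(** Without any unlikely constraint, the chain from the empty set to [E] would leave a positive
    number of solutions. Among pairs with an unlikely constraint, one with |F| minimal is taken: a
    proper subset [F'] with some [e'] of [F] would be a smaller pair. *)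
Lemma minimal_unlikely_constraint (rho : R) (E : {set {set 'I_t}}) :
  0 < rho -> (0 < n)%N -> (forall y, ~~ satisfies E y) ->
  exists F e,
   [/\ F \subset E, e \in E, e \notin F,
       solutions (e |: F) < rho * solutions F &
       forall F' e', F' \proper F -> e' \in F :\: F' ->
         rho * solutions F' <= solutions (e' |: F')].
Proof.
move=> rho0 n0 unsat.
pose P (p : {set {set 'I_t}} * {set 'I_t}) := [&& p.1 \subset E, p.2 \in E,
  p.2 \notin p.1 & solutions (p.2 |: p.1) < rho * solutions p.1].
have [p0 Pp0] : exists p, P p.
  apply/existsP; apply: contraT; rewrite negb_exists => /forallP noP.
  have step F' e : F' \proper E -> e \in E :\: F' ->
      rho * solutions F' <= solutions (e |: F').
    move=> /proper_sub FE; rewrite inE => /andP[eF eE].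
    have := noP (F', e); rewrite /P /= FE eE eF /= -leNgt; exact.
  have := solutions_chain (ltW rho0) step (sub0set E).
  rewrite {2}/solutions; have -> : [set y | satisfies E y] = set0.
    by apply/setP => y; rewrite !inE (negbTE (unsat y)).
  rewrite cards0 leNgt mulr_gt0 ?exprn_gt0 //.
  rewrite ltr0n; apply/card_gt0P; exists [ffun=> Ordinal n0]; rewrite inE.
  by apply/forall_inP => e; rewrite inE.
have [[F e] /= /and4P[/= FE eE eF lt_e] minF] :=
  arg_minnP (fun p : {set {set 'I_t}} * {set 'I_t} => #|p.1|) Pp0.
exists F, e; split => // F' e' F'F; rewrite inE => /andP[e'F' e'F].
rewrite leNgt; apply/negP => lt_e'.
have := minF (F', e'); rewrite /P /= lt_e' e'F' (subsetP FE) //.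
rewrite (subset_trans (proper_sub F'F) FE) => /(_ isT).
by rewrite leqNgt proper_card.
Qed.

Definition update y (v : 'I_t) (x : 'I_n) : point :=
  [ffun j => if j == v then x else y j].

Lemma sum_update (v : 'I_t) (G : point -> R) :
  \sum_y \sum_x G (update y v x) = n%:R * \sum_y G y.
Proof.
(* Swapping the new and the old value at v is an involution. *)
pose phi (p : point * 'I_n) := (update p.1 v p.2, p.1 v).
have phiK : involutive phi.
  case=> y x; rewrite /phi /=; congr pair; last by rewrite ffunE eqxx.
  by apply/ffunP => j; rewrite !ffunE; case: eqP => // ->.
rewrite pair_big /= (reindex_inj (inv_inj phiK)) /=.
rewrite -(pair_big predT predT (fun y (x : 'I_n) => G (update (update y v x) v (y v)))) /=.
rewrite mulr_sumr; apply: eq_bigr => y _.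
rewrite -[n in RHS]card_ord mulr_natl -sumr_const; apply: eq_bigr => x _; congr G.
by apply/ffunP => j; rewrite !ffunE; case: eqP => // ->.
Qed.

Section ThreeCoordinates.
Variables (a b c : 'I_t).
Hypotheses (ab : a != b) (ac : a != c) (bc : b != c).

Definition update3 y x1 x2 x3 := update (update (update y a x1) b x2) c x3.

Lemma update3E y x1 x2 x3 j : update3 y x1 x2 x3 j =
  if j == c then x3 else if j == b then x2 else if j == a then x1 else y j.
Proof. by rewrite !ffunE. Qed.

(** Resampling three coordinates leaves averages unchanged, which later allows all other coordinates
    to be fixed. *)
Lemma sum_update3 (G : point -> R) :
  \sum_y \sum_x1 \sum_x2 \sum_x3 G (update3 y x1 x2 x3) =
  n%:R ^+ 3 * \sum_y G y.
Proof.
rewrite (sum_update a (fun y => \sum_x2 \sum_x3 G (update (update y b x2) c x3))).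
rewrite (sum_update b (fun y => \sum_x3 G (update y c x3))).
by rewrite sum_update; ring.
Qed.

(** For [v] among [a], [b], [c], this depends only on the two other coordinates of the triple once
    the rest of [y] is fixed; it is thus one of the three graphs [g], [h], [k]. *)
Definition link_without F y (v : 'I_t) :=
  [forall f in F, (v \notin f) ==> ok f y].

(** A constraint missing [v] does not see the coordinate at [v], which may be reset to [y v].
    Sorting the members of [F] by a vertex they miss gives the three conjuncts. *)
Lemma satisfies_update3 F y x1 x2 x3 :
  (forall f, f \in F -> [|| a \notin f, b \notin f | c \notin f]) ->
  satisfies F (update3 y x1 x2 x3) =
  link_without F (update3 y (y a) x2 x3) a &&
  (link_without F (update3 y x1 x2 (y c)) c &&
   link_without F (update3 y x1 (y b) x3) b).
Proof.
move=> Fabc; have ba := negbTE ab; have ca := negbTE ac; have cb := negbTE bc.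
have loc v (f : {set 'I_t}) y1 y2 : v \notin f ->
    (forall j, j != v -> y1 j = y2 j) -> ok f y1 = ok f y2.
  move=> vf yE; apply: ok_local => j jf; apply: yE; apply: contraNneq vf => <-; exact: jf.
have oka (f : {set 'I_t}) : a \notin f -> ok f (update3 y x1 x2 x3) = ok f (update3 y (y a) x2 x3).
  by move=> af; apply: (loc a) => // j ja; rewrite !update3E (negbTE ja).
have okb (f : {set 'I_t}) : b \notin f -> ok f (update3 y x1 x2 x3) = ok f (update3 y x1 (y b) x3).
  by move=> bf; apply: (loc b) => // j jb; rewrite !update3E (negbTE jb).
have okc (f : {set 'I_t}) : c \notin f -> ok f (update3 y x1 x2 x3) = ok f (update3 y x1 x2 (y c)).
  by move=> cf; apply: (loc c) => // j jc; rewrite !update3E (negbTE jc).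
apply/forall_inP/and3P => [H | [/forall_inP Ha /forall_inP Hc /forall_inP Hb] f fF].
  by split; apply/forall_inP => f fF; apply/implyP => vf; rewrite -(oka, okb, okc) // H.
case/or3P: (Fabc f fF) => vf.
- by rewrite oka //; apply: implyP (Ha f fF) vf.
- by rewrite okb //; apply: implyP (Hb f fF) vf.
- by rewrite okc //; apply: implyP (Hc f fF) vf.
Qed.
End ThreeCoordinates.
(** The set [F] and the triple [e] come from [minimal_unlikely_constraint]; the triangles are the
    positions of [e] for which [F] holds, the rest of the placement being fixed by averaging. *)
Lemma unsatisfiable_triangles (rho : R) (d : nat) (E : {set {set 'I_t}}) :
  0 < rho -> rho <= 1 -> (0 < n)%N ->
  (forall e : {set 'I_t}, e \in E -> #|e| = 3%N) ->
  (forall v, (#|[set e in E | v \in e]| <= d)%N) ->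
  (forall y, ~~ satisfies E y) ->
  exists (a b c : 'I_t) (y : point) (g h k : 'I_n -> 'I_n -> bool),
    let triangles := \sum_x1 \sum_x2 \sum_x3 (k x2 x3 && (g x1 x2 && h x1 x3))%:R in
    [/\ (a < b)%N, (b < c)%N,
      \sum_x1 \sum_x2 \sum_x3
        (k x2 x3 && (g x1 x2 && h x1 x3 &&
          ok [set a; b; c] (update3 a b c y x1 x2 x3)))%:R <= 2 * rho * triangles &
      rho ^+ (3 * d) / 2 * n%:R ^+ 3 <= triangles].
Proof.
move=> rho0 rho1 n0 E3 Ed unsat.
have [F [e [FE eE eF lt_e chain]]] := minimal_unlikely_constraint rho0 n0 unsat.
have [a [b [c [ltab ltbc eabc]]]] := card3_sorted (E3 e eE).
have ab : a != b by rewrite neq_ltn ltab.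
have bc : b != c by rewrite neq_ltn ltbc.
have ac : a != c by rewrite neq_ltn (ltn_trans ltab ltbc).
have ae : a \in e by rewrite eabc !inE eqxx.
have be : b \in e by rewrite eabc !inE eqxx !orbT.
have ce : c \in e by rewrite eabc !inE eqxx !orbT.
(* The other members of [F] meet [e], and there are at most [3d] of them. The chain starts from [F0]
   and not from the empty set, so the loss does not depend on |F|. *)
pose F0 := [set f in F | [disjoint f & e]].
have F0F : F0 \subset F by apply/subsetP => f; rewrite inE => /andP[].
have card_F : (#|F :\: F0| <= 3 * d)%N.
  pose S v := [set f in E | v \in f].
  apply: (@leq_trans #|S a :|: S b :|: S c|).
    apply: subset_leq_card; apply/subsetP => f; rewrite !inE => /andP[+ fF].
    rewrite fF (subsetP FE) //= => /pred0Pn[v /andP[/= vf]].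
    by rewrite eabc !inE => /orP[/orP[]|] /eqP <-; rewrite vf ?orbT.
  apply: leq_trans (leq_card_setU _ _) _.
  apply: leq_trans (leq_add (leq_card_setU _ _) (leqnn _)) _.
  by rewrite !mulSn addn0 addnA !leq_add // Ed.
have F_ge : rho ^+ (3 * d) * solutions F0 <= solutions F.
  apply: le_trans (solutions_chain (ltW rho0) chain F0F).
  apply: ler_wpM2r; first exact: ler0n.
  by rewrite ler_wiXn2l // ltW.
pose T y := \sum_x1 \sum_x2 \sum_x3 (satisfies F (update3 a b c y x1 x2 x3))%:R : R.
pose U y := \sum_x1 \sum_x2 \sum_x3 (satisfies (e |: F) (update3 a b c y x1 x2 x3))%:R : R.
have sumT : \sum_y T y = n%:R ^+ 3 * solutions F.
  by rewrite (sum_update3 a b c (fun y => (satisfies F y)%:R)) sum_indicator.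
have sumU : \sum_y U y = n%:R ^+ 3 * solutions (e |: F).
  by rewrite (sum_update3 a b c (fun y => (satisfies (e |: F) y)%:R)) sum_indicator.
(* Members of [F0] do not see the resampled coordinates, so [T y] vanishes unless [y] itself
   satisfies [F0]. *)
have sat0 y x1 x2 x3 : satisfies F (update3 a b c y x1 x2 x3) -> satisfies F0 y.
  move=> /forall_inP H; apply/forall_inP => f; rewrite inE => /andP[/H okf dis].
  rewrite -(ok_local (y := update3 a b c y x1 x2 x3)) // => j jf.
  have je : j \notin e by rewrite (disjointFr dis jf).
  rewrite update3E; case: eqP => [jc|_]; first by rewrite jc ce in je.
  case: eqP => [jb|_]; first by rewrite jb be in je.
  by case: eqP => [ja|_ //]; rewrite ja ae in je.
have T0 y : ~~ satisfies F0 y -> T y = 0.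
  move=> ny; rewrite /T big1 // => x1 _; rewrite big1 // => x2 _; rewrite big1 // => x3 _.
  by rewrite (negbTE (contra (@sat0 y x1 x2 x3) ny)).
have U0 y : 0 <= U y.
  by do 3!(apply: sumr_ge0 => ? _); exact: ler0n.
have n3 : 0 < n%:R ^+ 3 :> R by rewrite exprn_gt0 // ltr0n.
pose q := rho ^+ (3 * d) / 2 * n%:R ^+ 3.
have q0 : 0 <= q by rewrite /q mulr_ge0 ?divr_ge0 ?exprn_ge0 // ltW.
(* If every [y] failed, [T y] would be at most [U y / (2 rho)], plus [q] when [y] satisfies [F0].
   Summed over [y], the first terms stay below half of the sum of [T] and the second ones do not
   exceed half of it. *)
have [y [y1 y2]] : exists y, U y <= 2 * rho * T y /\ q <= T y.
  case: (pselect (exists y, U y <= 2 * rho * T y /\ q <= T y)) => // noy; exfalso.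
  have Ty y : T y <= U y / (2 * rho) + q * (satisfies F0 y)%:R.
    have [sy|/T0 ->] := boolP (satisfies F0 y); last first.
      by rewrite mulr0 addr0 divr_ge0 // mulr_ge0 // ltW.
    rewrite mulr1 leNgt; apply/negP => lt_T; apply: noy; exists y.
    have U2 : 0 <= U y / (2 * rho) by rewrite divr_ge0 // mulr_ge0 // ltW.
    split; last by lra.
    have : U y / (2 * rho) <= T y by lra.
    by rewrite ler_pdivrMr ?mulr_gt0 // mulrC.
  have : \sum_y T y <= \sum_y (U y / (2 * rho) + q * (satisfies F0 y)%:R).
    exact: ler_sum.
  rewrite big_split -mulr_suml -mulr_sumr sumT sumU sum_indicator -/(solutions F0).
  have : n%:R ^+ 3 * solutions (e |: F) / (2 * rho) < n%:R ^+ 3 * solutions F / 2.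
    by rewrite ltr_pdivrMr ?mulr_gt0 //; move: lt_e; rewrite -(ltr_pM2l n3); lra.
  have : q * solutions F0 <= n%:R ^+ 3 * solutions F / 2.
    rewrite /q; have := ler_wpM2l (ltW n3) F_ge; lra.
  rewrite /=; lra.
exists a, b, c, y, (fun x1 x2 => link_without F (update3 a b c y x1 x2 (y c)) c),
  (fun x1 x3 => link_without F (update3 a b c y x1 (y b) x3) b),
  (fun x2 x3 => link_without F (update3 a b c y (y a) x2 x3) a).
(* A triple containing [a], [b] and [c] would be [e] itself, which is not in [F]. *)
have Fabc f : f \in F -> [|| a \notin f, b \notin f | c \notin f].
  move=> fF; rewrite -!negb_and; apply: contra eF => /and3P[af bf cf].
  suff -> : e = f by [].
  apply/eqP; rewrite eqEcard (E3 e eE) (E3 f (subsetP FE f fF)) leqnn andbT.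
  by apply/subsetP => v; rewrite eabc !inE => /orP[/orP[]|] /eqP ->.
have satE x1 x2 x3 := satisfies_update3 ab ac bc y x1 x2 x3 Fabc.
have TE : T y = \sum_x1 \sum_x2 \sum_x3
    (link_without F (update3 a b c y (y a) x2 x3) a &&
    (link_without F (update3 a b c y x1 x2 (y c)) c &&
     link_without F (update3 a b c y x1 (y b) x3) b))%:R.
  by do 3!(apply: eq_bigr => ? _); rewrite satE.
split => //; rewrite -TE //.
apply: le_trans y1; rewrite le_eqVlt; apply/orP; left; apply/eqP.
by do 3!(apply: eq_bigr => ? _); rewrite satisfiesU1 satE eabc -!andbA.
Qed.
End LocalConstraints.

(** * Ordered copies in consecutive intervals *)

Lemma increasing_enumeration n s (X : {set 'I_n}) : (s <= #|X|)%N ->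
  exists phi : 'I_s -> 'I_n,
    (forall i j : 'I_s, (i < j)%N -> (phi i < phi j)%N) /\ (forall i, phi i \in X).
Proof.
move=> sX; have lt_size (i : 'I_s) : (i < size (enum X))%N.
  by rewrite -cardE (leq_trans (ltn_ord i)).
case: (posnP #|X|) => [X0|/card_gt0P[x0 _]].
  have no_i (i : 'I_s) : False by have := lt_size i; rewrite -cardE X0.
  by exists (fun i => False_rect _ (no_i i)); split=> [i|i]; case: (no_i i).
exists (fun i => nth x0 (enum X) i); split=> [i j ij|i]; last first.
  by rewrite -mem_enum mem_nth.
apply: (sorted_ltn_nth (leT := fun i j : 'I_n => (i < j)%N)) => //.
- by move=> ? ? ?; apply: ltn_trans.
- exact: sorted_enum_ord.
- exact: lt_size.
- exact: lt_size.
Qed.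

Lemma mixed_radix_lt t n (j : 'I_t) (x : 'I_n) : (j * n + x < t * n)%N.
Proof.
apply: (@leq_trans (j.+1 * n)); first by rewrite mulSn addnC ltn_add2r.
by rewrite leq_mul2r ltn_ord orbT.
Qed.

Definition vertex t n (j : 'I_t) (x : 'I_n) : 'I_(t * n) :=
  Ordinal (mixed_radix_lt j x).

(** This makes every placement order preserving, whatever the positions inside the intervals. *)
Lemma vertex_ltl t n (j j' : 'I_t) (x x' : 'I_n) : (j < j')%N ->
  (vertex j x < vertex j' x')%N.
Proof.
move=> jj'; rewrite /vertex /=; apply: (@leq_trans (j.+1 * n)).
  by rewrite mulSn addnC ltn_add2r.
by apply: leq_trans (leq_addr _ _); rewrite leq_mul2r jj' orbT.
Qed.

Lemma increasing_inj N M (f : 'I_N -> 'I_M) :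
  (forall i j : 'I_N, (i < j)%N -> (f i < f j)%N) -> injective f.
Proof.
move=> f_incr i j fij; apply: val_inj => /=.
by case: (ltngtP i j) => // /f_incr; rewrite fij ltnn.
Qed.

(** The quotient of [v] by [s] selects the interval [a], [b] or [c], and the remainder selects the
    position in it. A hyperedge has one vertex in each part, so its image is one of the red
    triples. *)
Lemma red_tripartite_copy t n s (col : coloring (t * n)) (a b c : 'I_t)
    (X Y Z : {set 'I_n}) :
  (0 < s)%N -> (a < b)%N -> (b < c)%N ->
  (s <= #|X|)%N -> (s <= #|Y|)%N -> (s <= #|Z|)%N ->
  (forall x y z, x \in X -> y \in Y -> z \in Z ->
    ~~ col [set vertex a x; vertex b y; vertex c z]) ->
  ordered_copy_in (complete_tripartite s) (red_part col).
Proof.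
move=> s0 ab bc /increasing_enumeration[phiX [incX inX]].
move=> /increasing_enumeration[phiY [incY inY]].
move=> /increasing_enumeration[phiZ [incZ inZ]] red.
pose idx k := if k is 0%N then a else if k is 1%N then b else c.
pose phi k := if k is 0%N then phiX else if k is 1%N then phiY else phiZ.
pose f (v : 'I_(3 * s)) :=
  vertex (idx (v %/ s)%N) (phi (v %/ s)%N (Ordinal (ltn_pmod v s0))).
have div3 (v : 'I_(3 * s)) : (v %/ s < 3)%N by rewrite ltn_divLR.
have f_incr (u v : 'I_(3 * s)) : (u < v)%N -> (f u < f v)%N.
  move=> uv; have := leq_div2r s (ltnW uv).
  rewrite leq_eqVlt => /orP[/eqP eq_div|lt_div].
    have lt_mod : (u %% s < v %% s)%N.
      by rewrite -(ltn_add2l (u %/ s * s)) -divn_eq eq_div -divn_eq.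
    rewrite /f eq_div ltn_add2l.
    by case: (v %/ s)%N => [|[|k]] /=; [apply: incX | apply: incY | apply: incZ].
  apply: vertex_ltl; move: lt_div (div3 v).
  case: (u %/ s)%N => [|[|k]]; case: (v %/ s)%N => [|[|[|l]]] //= _ _.
  exact: ltn_trans bc.
exists f; split => // e; rewrite !inE => /andP[/eqP e3 /forallP parts].
rewrite card_imset ?e3 //=; last exact: increasing_inj.
have in_part (k : 'I_3) (v : 'I_(3 * s)) : (v \in interval_part s k) = (v %/ s == k)%N.
  rewrite inE -leq_divRL // -ltn_divLR // ltnS andbC.
  by rewrite [RHS]eqn_leq.
have rep (k : 'I_3) : exists u : 'I_(3 * s), (u %/ s)%N = k /\
    forall v : 'I_(3 * s), v \in e -> (v %/ s)%N = k -> v = u.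
  have /cards1P[u eu] := parts k; exists u; split.
    have : u \in e :&: interval_part s k by rewrite eu inE.
    by rewrite inE in_part => /andP[_ /eqP].
  by move=> v ve vk; apply/set1P; rewrite -eu inE ve in_part vk /=.
have [u0 [u0k u0e]] := rep (inord 0).
have [u1 [u1k u1e]] := rep (inord 1).
have [u2 [u2k u2e]] := rep (inord 2).
rewrite !inordK // in u0k u0e u1k u1e u2k u2e.
have eE : e = [set u0; u1; u2].
  apply/eqP; rewrite eqEcard e3 -setUA.
  have -> /= : (#|u0 |: [set u1; u2]| <= 3)%N.
    by rewrite cardsU1 cards2; case: (_ \notin _); case: (_ != _).
  rewrite andbT; apply/subsetP => v ve; rewrite !inE; move: (div3 v).
  case vk: (v %/ s)%N => [|[|[|k]]] // _.
  - by rewrite (u0e v ve vk) eqxx.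
  - by rewrite (u1e v ve vk) eqxx orbT.
  - by rewrite (u2e v ve vk) eqxx !orbT.
rewrite eE !imsetU !imset_set1 /f u0k u1k u2k /=.
exact: red.
Qed.

(** A placement satisfying all hyperedges is a blue copy; otherwise the triangles of
    [unsatisfiable_triangles] feed [dense_pairs] and then the iteration. *)
Lemma ordered_arrow_of_large (R : realFieldType) (t n s d D m : nat)
    (H : ohypergraph3 t) (rho : R) :
  let a := 1 - 4 * rho in
  let b := a * (1 - m%:R^-1) in
  let E := (8 * (m * D))%N in
  let tau := a * (b ^+ s / D%:R) / (2 * m * D)%:R * b ^+ E in
  max_degree H = d -> (0 < s)%N -> 0 < rho < 1 / 8 -> (0 < D)%N -> (1 < m)%N ->
  8 <= rho ^+ (3 * d) * D%:R ->
  (8 * m * D * s)%:R <= a * n%:R ->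
  4 * s%:R * D%:R ^+ E.+1 <= b ^+ s * tau ^+ s * n%:R ->
  s%:R * D%:R ^+ E <= (b ^+ s / (4 * D%:R)) ^+ s.+1 * tau ^+ s * n%:R ->
  ordered_arrow (t * n) H (complete_tripartite s).
Proof.
move=> a b E tau Hd s0 /andP[rho0 rho8] D0 m1 D_ge n_ge1 n_ge2 n_ge3 col.
have a_gt0 : 0 < a by rewrite /a; lra.
have a_le1 : a <= 1 by rewrite /a; lra.
have n0 : (0 < n)%N.
  rewrite lt0n; apply/eqP => n_eq0; move: n_ge1; rewrite n_eq0 mulr0 leNgt ltr0n.
  by rewrite !muln_gt0 D0 s0 (ltnW m1).
have D0R : 0 < D%:R :> R by rewrite ltr0n.
pose ok (e : {set 'I_t}) (y : {ffun 'I_t -> 'I_n}) := col [set vertex j (y j) | j in e].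
have ok_local (e : {set 'I_t}) (y y' : {ffun 'I_t -> 'I_n}) :
    {in e, forall j, y j = y' j} -> ok e y = ok e y'.
  move=> yy'; rewrite /ok; congr col; apply: eq_in_imset => j je; by rewrite yy'.
case: (pselect (exists y, satisfies ok (hyperedges H) y)) => [[y sat]|unsat].
  left; exists (fun j => vertex j (y j)).
  have incr (i j : 'I_t) : (i < j)%N -> (vertex i (y i) < vertex j (y j))%N.
    exact: vertex_ltl.
  split => // e eH; rewrite !inE card_imset; last exact: increasing_inj.
  rewrite (hyperedges_uniform eH) eqxx /=.
  by move/forall_inP: sat; apply.
right.
have rho1 : rho <= 1 by lra.
have degH v : (#|[set e in hyperedges H | v \in e]| <= d)%N.
  by rewrite -Hd; apply: (leq_bigmax (F := degree H)).
have unsat' y : ~~ satisfies ok (hyperedges H) y.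
  by apply/negP => sat; apply: unsat; exists y.
have [p [q [r [y [g [h [k [pq qr blue_le T_ge]]]]]]]] := unsatisfiable_triangles
  ok_local rho0 rho1 n0 (@hyperedges_uniform _ H) degH unsat'.
pose blue x1 x2 x3 := ok [set p; q; r] (update3 p q r y x1 x2 x3).
have card_n : (0 < #|'I_n|)%N by rewrite card_ord.
(* The bound [8 <= rho^(3d) D] turns the density [rho^(3d) / 2] into [4 / D]. *)
have T_ge' : 4 / D%:R * (#|'I_n|%:R * #|'I_n|%:R * #|'I_n|%:R) <=
    \sum_x1 \sum_x2 \sum_x3 (k x2 x3 && (g x1 x2 && h x1 x3))%:R :> R.
  apply: le_trans T_ge; rewrite card_ord.
  rewrite [n%:R ^+ 3](_ : _ = n%:R * n%:R * n%:R); last by ring.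
  apply: ler_wpM2r; first by rewrite !mulr_ge0.
  by rewrite ler_pdivrMr // ; lra.
have dens := dense_pairs (blue := blue) rho0 D0 card_n blue_le T_ge'.
have red_gh x1 x2 x3 : g x1 x2 && h x1 x3 && ~~ blue x1 x2 x3 -> g x1 x2 && h x1 x3.
  by case/andP.
have cardR : #|'I_n|%:R = n%:R :> R by rewrite card_ord.
have n_ge1' : (8 * m * D * s)%:R <= a * #|'I_n|%:R by rewrite cardR.
have [X [Y [Z [sX sY sZ red]]]] :=
  red_complete_tripartite (red := fun x1 x2 x3 => g x1 x2 && h x1 x3 && ~~ blue x1 x2 x3)
    red_gh D0 m1 s0 a_gt0 a_le1 card_n
    (fun x2 x3 K23 => let: And3 _ K _ := and3P K23 in K)
    (fun x2 x3 K23 => let: And3 _ _ K := and3P K23 in K)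
    card_n card_n dens n_ge1' cardR cardR n_ge2 n_ge3.
apply: (red_tripartite_copy s0 pq qr sX sY sZ) => x1 x2 x3 x1X x2Y x3Z.
have := red _ _ _ x1X x2Y x3Z => /andP[_]; rewrite /blue /ok !imsetU !imset_set1.
have pr := ltn_trans pq qr.
have [qp rq rp] : [/\ p == q = false, p == r = false & q == r = false].
  by split; apply: ltn_eqF.
by rewrite !update3E !eqxx qp rq rp.
Qed.

Lemma exists_ordered_ramsey t n (H : ohypergraph3 t) (G : ohypergraph3 n) N0 :
  ordered_arrow N0 H G ->
  exists2 N, is_ordered_ramsey H G N & (N <= N0)%N.
Proof.
move=> arr; have exN : exists N, `[< ordered_arrow N H G >] by exists N0; apply/asboolP.
case: (ex_minnP exN) => N /asboolP NHG minN; exists N; last exact/minN/asboolP.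
by split => // M /asboolP/minN.
Qed.

(** A separate case, because for [d = 0] the first term of the exponent in the theorem vanishes.
    There are no hyperedges, so the identity is a copy. *)
Lemma max_degree0_arrow t n (H : ohypergraph3 t) (G : ohypergraph3 n) :
  max_degree H = 0%N -> ordered_arrow t H G.
Proof.
move=> H0 c; left; exists id; split => // e eH; exfalso.
have [v ve] : exists v, v \in e.
  by apply/set0Pn; rewrite -card_gt0 (hyperedges_uniform eH).
have := leq_bigmax (F := degree H) v; rewrite -/(max_degree H) H0 leqn0 cards_eq0.
by move=> /eqP/setP/(_ e); rewrite !inE eH ve.
Qed.

(** * Numerical estimates *)

Lemma bernoulli_ineq (R : realFieldType) (x : R) (i : nat) :
  0 <= x <= 1 -> 1 - i%:R * x <= (1 - x) ^+ i.
Proof.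
case/andP=> x0 x1; elim: i => [|i IH]; first by rewrite mul0r subr0 expr0.
have := ler_wpM2l (_ : 0 <= 1 - x) IH; rewrite subr_ge0 -exprS => /(_ x1).
apply: le_trans; rewrite -natr1.
have : 0 <= i%:R * (x * x) by rewrite !mulr_ge0.
by lra.
Qed.

(** For [k] the integer part of [m/2], Bernoulli gives [(1 - 1/m)^k >= 1/2], and [m <= 3k] since
    [m >= 2]. *)
Lemma one_sub_inv_expn_ge (R : realFieldType) (m : nat) : (1 < m)%N ->
  1 <= (1 - m%:R^-1) ^+ m * 8 :> R.
Proof.
move=> m1; have m0 : 0 < m%:R :> R by rewrite ltr0n ltnW.
have x1 : m%:R^-1 <= 1 :> R by rewrite invf_le1 // ler1n ltnW.
have x0 : 0 <= m%:R^-1 :> R by rewrite invr_ge0 ltW.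
set k := m./2; have m3k : (m <= k * 3)%N by rewrite /k; have := odd_double_half m; lia.
have half : 2^-1 <= (1 - m%:R^-1) ^+ k :> R.
  apply: le_trans (bernoulli_ineq k _); last by rewrite x0 x1.
  have : k%:R * m%:R^-1 <= 2^-1 :> R.
    rewrite ler_pdivrMr // mulrC ler_pdivlMr // -natrM ler_nat /k muln2.
    by rewrite -[leqRHS](odd_double_half m) leq_addl.
  by lra.
have : 2^-1 ^+ 3 <= (1 - m%:R^-1) ^+ m :> R.
  apply: (@le_trans _ _ (((1 - m%:R^-1) ^+ k) ^+ 3)).
    by rewrite lerXn2r // ?nnegrE ?invr_ge0 // exprn_ge0 // subr_ge0.
  by rewrite -exprM ler_wiXn2l // ?subr_ge0 // lerBlDr lerDl.
by rewrite !exprS expr0; lra.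
Qed.

Lemma natr_le_exp2 (R : realFieldType) (k : nat) : k%:R <= 2 ^+ k :> R.
Proof. by rewrite -natrX ler_nat ltnW // ltn_expl. Qed.

Lemma exp2_ge1 (R : realFieldType) (k : nat) : 1 <= 2 ^+ k :> R.
Proof. by rewrite exprn_ege1 // ler1n. Qed.

Lemma exp2_le (R : realFieldType) (j k : nat) : (j <= k)%N -> 2 ^+ j <= 2 ^+ k :> R.
Proof. by move=> jk; rewrite ler_weXn2l // ler1n. Qed.

Lemma tau_exponent (m D : nat) : (1 < m)%N -> (0 < D)%N ->
  (1 + m + D + D + (1 + 3 * m + (8 * (m * D) + 24 * D)) <= 30 * (m * D))%N.
Proof.
move=> m1 D0; have : (2 * D <= m * D)%N by rewrite leq_mul2r m1 orbT.
have : (m <= m * D)%N by rewrite leq_pmulr.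
move: (m * D)%N => p; lia.
Qed.

(** These are the powers of 2 sufficient for the three largeness conditions on [n]. The estimate
    [D <= 2^D] turns [D^E] into an exponent [8 m D^2], hence the square of [D] in [q]. *)
Lemma exponents_le (m D s : nat) (q := (m * (D * D) * s)%N) :
  (1 < m)%N -> (0 < D)%N -> (0 < s)%N ->
  [/\ (3 + m + D + s <= 50 * q)%N,
     (2 + s + D * (8 * (m * D)).+1 + (3 * m + 30 * (m * D) * s) <= 50 * q)%N &
     (s + D * (8 * (m * D)) + ((3 * m + (2 + D)) * s.+1 + 30 * (m * D) * s)
       <= 50 * q)%N].
Proof.
move=> m1 D0 s0; have m0 := ltnW m1.
have DD : (D <= D * D)%N by rewrite leq_pmulr.
have DD1 : (1 <= D * D)%N by rewrite muln_gt0 D0.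
have q1 : (m * (D * D) <= q)%N by rewrite leq_pmulr.
have q2 : (m * D * s <= q)%N by rewrite leq_mul // leq_mul.
have q3 : (m * s <= q)%N by rewrite leq_mul // leq_pmulr.
have q4 : (D * s <= q)%N by rewrite leq_mul // (leq_trans DD) // leq_pmull.
have q5 : (2 <= q)%N by apply: leq_trans q3; rewrite (leq_trans m1) // leq_pmulr.
have q6 : (s <= q)%N by apply: leq_trans q4; rewrite leq_pmull.
have q7 : (D <= q)%N by apply: leq_trans q4; rewrite leq_pmulr.
have q8 : (m <= q)%N by apply: leq_trans q3; rewrite leq_pmulr.
have -> : (D * (8 * (m * D)) = 8 * (m * (D * D)))%N by rewrite mulnCA [(D * (m * D))%N]mulnCA.
have -> : (D * (8 * (m * D)).+1 = D + 8 * (m * (D * D)))%N.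
  by rewrite mulnS mulnCA [(D * (m * D))%N]mulnCA.
have -> : ((3 * m + (2 + D)) * s.+1 = 3 * m + 2 + D + (3 * (m * s) + 2 * s + D * s))%N.
  by clear; lia.
rewrite -!(mulnA 30).
clear m1 D0 s0 m0 DD DD1; clearbody q.
move: (m * (D * D))%N (m * D * s)%N (m * s)%N (D * s)%N q1 q2 q3 q4 => x1 x2 x3 x4.
by split; lia.
Qed.

Lemma sqr_exponents_le s : (0 < s)%N ->
  [/\ (1 <= 3 * s ^ 2)%N, (s + s ^ 2 <= 3 * s ^ 2)%N &
      (s * s.+1 + s ^ 2 <= 3 * s ^ 2)%N].
Proof.
move=> s0; have : (s <= s * s)%N by rewrite leq_pmulr.
rewrite mulnS -mulnn; move: (s * s)%N => p; split; lia.
Qed.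

Section Numerics.
Variables (R : realFieldType) (a : R) (s m D n : nat).
Hypotheses (a_ge : 1 / 2 <= a) (a_le1 : a <= 1) (s_gt0 : (0 < s)%N).
Hypotheses (sm : (s <= m ^ 2)%N) (m_gt1 : (1 < m)%N) (D_gt0 : (0 < D)%N).
Hypothesis n_large : 2 ^+ (50 * (m * (D * D) * s)) <= a ^+ (3 * s ^ 2) * n%:R.

Let b := a * (1 - m%:R^-1).
Let E := (8 * (m * D))%N.
Let tau := a * (b ^+ s / D%:R) / (2 * m * D)%:R * b ^+ E.

Let m_gt0 : (0 < m)%N. Proof. exact: ltnW. Qed.
Let a_gt0 : 0 < a. Proof. by move: a_ge; lra. Qed.
Let x_gt0 : 0 < 1 - m%:R^-1 :> R.
Proof. by rewrite subr_gt0 invf_lt1 ?ltr1n // ltr0n ltnW. Qed.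
Let x_le1 : 1 - m%:R^-1 <= 1 :> R.
Proof. by rewrite gerBl invr_ge0 ler0n. Qed.
Let b_gt0 : 0 < b. Proof. exact: mulr_gt0. Qed.
Let D0 : 0 < D%:R :> R. Proof. by rewrite ltr0n. Qed.
Let m0 : 0 < m%:R :> R. Proof. by rewrite ltr0n ltnW. Qed.

(** This is where [m] of order sqrt [s] matters: [s <= m^2] gives [(1 - 1/m)^s >= 8^(-m)]. *)
Lemma expr_b_s : a ^+ s <= b ^+ s * 2 ^+ (3 * m).
Proof.
rewrite /b exprMn -mulrA ler_peMr ?exprn_ge0 ?(ltW a_gt0) //.
apply: (@le_trans _ _ (((1 - m%:R^-1) ^+ m * 8) ^+ m)).
  by rewrite exprn_ege1 // one_sub_inv_expn_ge.
rewrite exprMn -exprM (_ : 8 = 2 ^+ 3); last by ring.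
rewrite -exprM; apply: ler_wpM2r; first by rewrite exprn_ge0.
by rewrite ler_wiXn2l // ltW.
Qed.

(** Here [a >= 1/2] costs [2^E], and [(1 - 1/m)^(8mD) >= 8^(-8D)] costs [2^(24D)]. *)
Lemma expr_b_E : 1 <= b ^+ E * 2 ^+ (E + 24 * D).
Proof.
rewrite /b exprMn exprD mulrACA -exprMn.
rewrite mulr_ege1 // ?exprn_ege1 //; first by move: a_ge; lra.
rewrite /E mulnCA.
rewrite -[24%N]/(3 * 8)%N -mulnA.
rewrite [_ ^+ (m * _)]exprM [2 ^+ (3 * _)]exprM -exprMn exprn_ege1 //.
rewrite (_ : 2 ^+ 3 = 8); last by ring.
exact: one_sub_inv_expn_ge.
Qed.

(** The power [a^s] is kept, since it produces the logarithmic term of the theorem; the remaining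
    powers of [a] are bounded through [a >= 1/2] and absorbed into powers of 2. *)
Lemma tau_ge : a ^+ s <= tau * 2 ^+ (30 * (m * D)).
Proof.
have hb := expr_b_s; have hE := expr_b_E.
have bs0 : 0 < b ^+ s by rewrite exprn_gt0.
have bE0 : 0 < b ^+ E by rewrite exprn_gt0.
have tau_eq : tau * (2 * m * D * D)%:R = a * b ^+ s * b ^+ E.
  by rewrite /tau !natrM; field; rewrite !gt_eqF.
have tau0 : 0 < tau.
  by rewrite /tau !mulr_gt0 ?invr_gt0 // ltr0n !muln_gt0 D_gt0 m_gt0.
have le1 : a ^+ s <= a * b ^+ s * b ^+ E * 2 ^+ (1 + 3 * m + (E + 24 * D)).
  have -> : a * b ^+ s * b ^+ E * 2 ^+ (1 + 3 * m + (E + 24 * D)) =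
    (b ^+ s * 2 ^+ (3 * m)) * ((a * 2) * (b ^+ E * 2 ^+ (E + 24 * D))).
    by rewrite !exprD; ring.
  apply: le_trans hb _; rewrite ler_peMr ?mulr_ge0 ?exprn_ge0 ?(ltW b_gt0) //.
  by rewrite mulr_ege1 //; move: a_ge; lra.
apply: le_trans le1 _; rewrite -tau_eq -mulrA ler_pM2l //.
apply: (@le_trans _ _ (2 ^+ (1 + m + D + D) * 2 ^+ (1 + 3 * m + (E + 24 * D)))).
  rewrite ler_pM2r ?exprn_gt0 // !natrM !exprD expr1.
  by rewrite !ler_pM ?mulr_ge0 ?natr_le_exp2.
by rewrite -exprD exp2_le // tau_exponent.
Qed.

Lemma n_large_pow u k : (u <= 3 * s ^ 2)%N -> (k <= 50 * (m * (D * D) * s))%N ->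
  2 ^+ k <= a ^+ u * n%:R.
Proof.
move=> us /(exp2_le R)/le_trans; apply; apply: le_trans n_large _.
by rewrite ler_wpM2r // ler_wiXn2l // ltW.
Qed.

Let bs0 : 0 < b ^+ s. Proof. by rewrite exprn_gt0. Qed.
Let tau0 : 0 < tau.
Proof. by rewrite /tau !mulr_gt0 ?invr_gt0 ?exprn_gt0 // ltr0n !muln_gt0 D_gt0 m_gt0. Qed.

Lemma large_for_distinctness : (8 * m * D * s)%:R <= a * n%:R.
Proof.
have [k1 k2 k3] := exponents_le m_gt1 D_gt0 s_gt0.
have [u1 u2 u3] := sqr_exponents_le s_gt0.
rewrite -[a in leRHS]expr1; apply: le_trans (n_large_pow u1 k1).
rewrite !natrM !exprD (_ : 2 ^+ 3 = 8); last by ring.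
by rewrite !ler_pM ?mulr_ge0 ?natr_le_exp2.
Qed.

Lemma tau_s_ge : a ^+ (s ^ 2) <= tau ^+ s * 2 ^+ (30 * (m * D) * s).
Proof.
rewrite -mulnn.
rewrite [a ^+ _]exprM [2 ^+ _]exprM -exprMn lerXn2r ?nnegrE ?tau_ge //.
  by rewrite exprn_ge0 // ltW.
by rewrite mulr_ge0 ?exprn_ge0 // ltW.
Qed.

Lemma large_for_left_side : 4 * s%:R * D%:R ^+ E.+1 <= b ^+ s * tau ^+ s * n%:R.
Proof.
have [k1 k2 k3] := exponents_le m_gt1 D_gt0 s_gt0.
have [u1 u2 u3] := sqr_exponents_le s_gt0.
set v := (3 * m + 30 * (m * D) * s)%N.
have v0 : 0 < 2 ^+ v :> R by rewrite exprn_gt0.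
rewrite -(ler_pM2r v0).
apply: (@le_trans _ _ (2 ^+ (2 + s + D * E.+1 + v))).
  rewrite [leRHS]exprD ler_pM2r // !exprD exprM (_ : 2 ^+ 2 = 4); last by ring.
  rewrite !ler_pM ?mulr_ge0 ?exprn_ge0 ?natr_le_exp2 //.
  by rewrite lerXn2r ?nnegrE ?exprn_ge0 ?natr_le_exp2.
apply: le_trans (n_large_pow u2 k2) _.
rewrite mulrAC ler_wpM2r // [2 ^+ v]exprD [a ^+ _]exprD.
by rewrite mulrACA ler_pM ?exprn_ge0 ?(ltW a_gt0) ?expr_b_s ?tau_s_ge.
Qed.

Lemma large_for_right_side :
  s%:R * D%:R ^+ E <= (b ^+ s / (4 * D%:R)) ^+ s.+1 * tau ^+ s * n%:R.
Proof.
have [k1 k2 k3] := exponents_le m_gt1 D_gt0 s_gt0.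
have [u1 u2 u3] := sqr_exponents_le s_gt0.
(* The losses to clear: [3m + 2 + D] for each of the [s + 1] factors [b^s / (4D)], and that of
   [tau_s_ge]. *)
set v := ((3 * m + (2 + D)) * s.+1 + 30 * (m * D) * s)%N.
have v0 : 0 < 2 ^+ v :> R by rewrite exprn_gt0.
have lam_ge : a ^+ s <= b ^+ s / (4 * D%:R) * 2 ^+ (3 * m + (2 + D)).
  have -> : b ^+ s / (4 * D%:R) * 2 ^+ (3 * m + (2 + D)) =
    (b ^+ s * 2 ^+ (3 * m)) * (2 ^+ D / D%:R).
    by rewrite !exprD; field; rewrite gt_eqF.
  apply: le_trans expr_b_s _; rewrite ler_peMr ?mulr_ge0 ?exprn_ge0 ?(ltW b_gt0) //.
  by rewrite ler_pdivlMr // mul1r natr_le_exp2.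
rewrite -(ler_pM2r v0).
apply: (@le_trans _ _ (2 ^+ (s + D * E + v))).
  rewrite [leRHS]exprD ler_pM2r // [2 ^+ (s + _)]exprD [2 ^+ (D * _)]exprM.
  have DE : D%:R ^+ E <= (2 ^+ D) ^+ E :> R.
    by rewrite lerXn2r ?nnegrE ?exprn_ge0 // natr_le_exp2.
  exact: ler_pM (ler0n _ _) (exprn_ge0 _ (ler0n _ _)) (natr_le_exp2 R s) DE.
apply: le_trans (n_large_pow u3 k3) _.
rewrite mulrAC ler_wpM2r // [2 ^+ v]exprD [a ^+ _]exprD.
rewrite mulrACA ler_pM ?exprn_ge0 ?(ltW a_gt0) ?tau_s_ge //.
rewrite [a ^+ _]exprM [2 ^+ _]exprM -exprMn lerXn2r ?nnegrE ?exprn_ge0 ?(ltW a_gt0) //.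
by rewrite mulr_ge0 ?exprn_ge0 // divr_ge0 ?mulr_ge0 // ltW.
Qed.
End Numerics.

(** * Real exponents and choice of the parameters *)

Lemma powR2_log2 (R : realType) (x : R) : 0 < x -> 2 `^ (log2 x) = x.
Proof.
move=> x0; have ln2 : 0 < ln 2 :> R by rewrite ln_gt0 // ltr1n.
by rewrite /powR pnatr_eq0 /= /log2 divfK ?gt_eqF // lnK.
Qed.

Lemma log2_ge0 (R : realType) (x : R) : 1 <= x -> 0 <= log2 x.
Proof. by move=> x1; rewrite divr_ge0 ?ln_ge0 // ler1n. Qed.

Lemma powR_3half (R : realType) (x : R) : 0 <= x -> x `^ (3 / 2) = x * Num.sqrt x.
Proof.
move=> x0; have -> : 3 / 2 = 1 + 2^-1 :> R by lra.
rewrite powRD ?powRr1 ?powR12_sqrt //.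
by apply/implyP => /eqP; lra.
Qed.

Lemma exists_sqrt_bound (R : realType) (s : nat) : (0 < s)%N ->
  exists m : nat, [/\ (1 < m)%N, (s <= m ^ 2)%N & m%:R <= 3 * Num.sqrt s%:R :> R].
Proof.
move=> s0; have r1 : 1 <= Num.sqrt s%:R :> R by rewrite -[leLHS]sqrtr1 ler_wsqrtr // ler1n.
have r0 : 0 <= Num.sqrt s%:R :> R by rewrite sqrtr_ge0.
(* The value is above sqrt [s], at least 2, and at most [3] sqrt [s] because sqrt [s] is at least
   1. *)
exists (Num.trunc (Num.sqrt s%:R : R)).+2; split => //; last first.
  rewrite -addn2 natrD; have : (Num.trunc (Num.sqrt s%:R : R))%:R <= Num.sqrt s%:R :> R by rewrite truncn_le.
  by lra.
rewrite -(ler_nat R) natrX -[leLHS]sqr_sqrtr ?ler0n // lerXn2r ?nnegrE //.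
apply: le_trans (ltW (truncnS_gt _)) _; by rewrite ler_nat.
Qed.

(** Rounding [8 rho^(-3d)] up gives [D <= 16 rho^(-3d)]; squaring yields [rho^(-6d)], and
    [6d <= 30 d^2] as [d >= 1]. *)
Lemma exists_density_bound (R : realType) (rho : R) (d : nat) :
  0 < rho < 1 / 8 -> (0 < d)%N ->
  exists D : nat, [/\ (0 < D)%N, 8 <= rho ^+ (3 * d) * D%:R &
    D%:R ^+ 2 <= 256 * rho ^- (30 * d ^ 2)%N].
Proof.
case/andP=> rho0 rho8 d0.
have P0 : 0 < rho ^+ (3 * d) by rewrite exprn_gt0.
have P1 : rho ^+ (3 * d) <= 1 by rewrite exprn_ile1 ?(ltW rho0) //; lra.
have P1' : 1 <= (rho ^+ (3 * d))^-1 by rewrite invf_ge1.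
exists (Num.trunc (8 / rho ^+ (3 * d))).+1; split => //.
  by rewrite mulrC -ler_pdivrMr // ltW // truncnS_gt.
set D := _.+1; have D_le : D%:R <= 16 * (rho ^+ (3 * d))^-1.
  rewrite /D -natr1; have : (Num.trunc (8 / rho ^+ (3 * d)))%:R <= 8 / rho ^+ (3 * d).
    by rewrite truncn_le divr_ge0 // ltW.
  by lra.
apply: (@le_trans _ _ ((16 * (rho ^+ (3 * d))^-1) ^+ 2)).
  by rewrite lerXn2r ?nnegrE // mulr_ge0 // invr_ge0 ltW.
rewrite exprMn (_ : 16 ^+ 2 = 256); last by ring.
rewrite ler_pM2l // exprVn -exprM lef_pV2 ?posrE ?exprn_gt0 //.
by rewrite ler_wiXn2l ?(ltW rho0) //; [lra|nia].
Qed.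
Theorem theorem3 (R : realType) :
  exists C' : R,
    forall (t d s : nat) (H : ohypergraph3 t) (rho : R),
      max_degree H = d ->
      (0 < s)%N ->
      0 < rho < 1 / 8 ->
      exists2 N : nat,
        is_ordered_ramsey H (complete_tripartite s) N &
        N%:R <= t%:R *
          2 `^ (C' * (s%:R `^ (3 / 2) * rho ^- (30 * d ^ 2)%N * d%:R ^+ 6
                      + s%:R ^+ 2 * log2 (1 / (1 - 4 * rho)))).
Proof.
(* The constant has to exceed 51 * 3 * 256 = 39168 for the first term, and 3 for the second. *)
exists (200 ^+ 2) => t d s H rho Hd s0 rho_bounds.
have /andP[rho0 rho8] := rho_bounds.
set Y1 := _ * _ * _ ^+ 6; set Y2 := s%:R ^+ 2 * _.
set a := 1 - 4 * rho in Y2 *.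
have a_ge : 1 / 2 <= a by rewrite /a; lra.
have a_le1 : a <= 1 by rewrite /a; lra.
have a_gt0 : 0 < a by lra.
have ia_ge1 : 1 <= 1 / a by rewrite div1r invf_ge1.
have Y1_ge0 : 0 <= Y1.
  by rewrite /Y1 !mulr_ge0 ?powR_ge0 ?invr_ge0 ?exprn_ge0 ?ler0n // ltW.
have Y2_ge0 : 0 <= Y2 by rewrite /Y2 mulr_ge0 ?exprn_ge0 ?log2_ge0.
set W := 2 `^ _.
have W_ge1 : 1 <= W.
  by rewrite /W -[leLHS](powRr0 2) ler_powR ?ler1n // mulr_ge0 ?exprn_ge0 ?addr_ge0.
case: (posnP d) => [d0|d_gt0].
  have [N HN Nt] := exists_ordered_ramsey
    (max_degree0_arrow (complete_tripartite s) (etrans Hd d0)).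
  exists N => //; apply: (@le_trans _ _ t%:R); first by rewrite ler_nat.
  by rewrite ler_peMr.
have [m [m1 sm m_le]] := exists_sqrt_bound R s0.
have [D [D0 D_ge D_le]] := exists_density_bound rho_bounds d_gt0.
set k := (50 * (m * (D * D) * s))%N.
have k_le : (k.+1)%:R <= 200 ^+ 2 * Y1.
  have q1 : (1 <= m * (D * D) * s)%N by rewrite !muln_gt0 D0 s0 (ltnW m1).
  apply: (@le_trans _ _ (51 * (m * (D * D) * s))%:R); first by rewrite ler_nat /k; lia.
  have d6 : 1 <= d%:R ^+ 6 :> R by rewrite exprn_ege1 // ler1n.
  rewrite /Y1 powR_3half ?ler0n // !natrM -expr2.
  set r := Num.sqrt _ in m_le *; set P := rho ^- _ in D_le *.
  have P0 : 0 <= P by rewrite invr_ge0 exprn_ge0 // ltW.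
  have r0 : 0 <= r by exact: sqrtr_ge0.
  have mD : m%:R * D%:R ^+ 2 <= (3 * r) * (256 * P) by rewrite ler_pM ?sqr_ge0.
  apply: (@le_trans _ _ (51 * ((3 * r) * (256 * P) * s%:R))).
    by rewrite ler_pM2l // ler_pM2r // ltr0n.
  have sr0 : 0 <= s%:R * r * P by rewrite !mulr_ge0.
  have : s%:R * r * P <= s%:R * r * P * d%:R ^+ 6 by rewrite ler_peMr.
  by lra.
have W_ge : 2 ^+ k.+1 <= a ^+ (3 * s ^ 2) * W.
  rewrite /W mulrDr powRD; last by rewrite pnatr_eq0 implybT.
  have ge1 : 2 ^+ k.+1 <= 2 `^ (200 ^+ 2 * Y1).
    by rewrite -[leLHS]powR_mulrn // ler_powR ?ler1n.
  (* The second term of the exponent offsets [a^(3 s^2)], because [(1/a)^(s^2)] is [2] to the power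
     [Y2]. *)
  have ge2 : (1 / a) ^+ (3 * s ^ 2) <= 2 `^ (200 ^+ 2 * Y2).
    rewrite -[leLHS]powR_mulrn; last by rewrite (le_trans _ ia_ge1).
    rewrite -{1}(powR2_log2 (x := 1 / a)); last by rewrite (lt_le_trans _ ia_ge1).
    rewrite -powRrM ler_powR ?ler1n // natrM natrX mulrC -mulrA -/Y2.
    by apply: ler_wpM2r => //; lra.
  have a_pow : 0 < a ^+ (3 * s ^ 2) by rewrite exprn_gt0.
  have ge3 : 1 <= a ^+ (3 * s ^ 2) * 2 `^ (200 ^+ 2 * Y2).
    have := ler_wpM2l (ltW a_pow) ge2.
    by rewrite div1r exprVn mulfV // gt_eqF.
  by rewrite mulrCA -[leLHS]mulr1 ler_pM ?exprn_ge0.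
set n := Num.trunc W.
have n_le : n%:R <= W by rewrite truncn_le (le_trans _ W_ge1).
(* Rounding [W] down loses at most 1, since the power of [a] is at most 1; the spare factor 2 in
   [2 ^+ k.+1] covers it. *)
have n_large : 2 ^+ k <= a ^+ (3 * s ^ 2) * n%:R.
  have a_pow : 0 <= a ^+ (3 * s ^ 2) by rewrite exprn_ge0 // ltW.
  have a_pow1 : a ^+ (3 * s ^ 2) <= 1 by rewrite exprn_ile1 // ltW.
  have := ler_wpM2l a_pow (ltW (truncnS_gt W)); rewrite -/n -natr1 mulrDr mulr1.
  have := exp2_ge1 R k; move: W_ge; rewrite exprS; lra.
have arrow := ordered_arrow_of_large Hd s0 rho_bounds D0 m1 D_ge
  (large_for_distinctness a_ge a_le1 s0 m1 D0 n_large)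
  (large_for_left_side a_ge a_le1 s0 sm m1 D0 n_large)
  (large_for_right_side a_ge a_le1 s0 sm m1 D0 n_large).
have [N HN N_le] := exists_ordered_ramsey arrow.
exists N => //; apply: (@le_trans _ _ (t * n)%:R); first by rewrite ler_nat.
by rewrite natrM ler_wpM2l.
Qed.
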